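(* Let $\alpha>0$ and $b\in\mathbb R$. When the Lévy process $X$ has bounded variation paths, the stochastic differential equation $$Y^b_t=X_t-\int_0^th^b(Y^b_s)\,ds,\qquad t\ge0,$$ has a unique strong solution, where, $\delta$ denoting the drift of $X$, $h^b(y)=\alpha1_{(b,\infty)}(y)$ if $\delta\notin[0,\alpha]$ and $h^b(y)=\alpha1_{(b,\infty)}(y)+\delta1_{\{b\}}(y)$ if $\delta\in[0,\alpha]$.
   Context: $X=\{X_t:t\ge0\}$ is a real-valued Lévy process (started from an arbitrary $x\in\mathbb R$) with natural filtration $\mathbb F$, Gaussian coefficient $\sigma$ and Lévy measure $\Pi$. It has bounded variation paths iff $\sigma=0$ and $\int_{(-1,1)\setminus\{0\}}|x|\Pi(dx)<\infty$; then its drift $\delta\in\mathbb R$ is defined by $\mathbb E_0[e^{i\lambda X_t}]=\exp(-t\{-i\delta\lambda+\int_{\mathbb R\setminus\{0\}}(1-e^{i\lambda x})\Pi(dx)\})$, equivalently $X_t=X_0+\delta t+\sum_{s\in(0,t]}(X_s-X_{s-})$. A unique strong solution means: an $\mathbb F$-adapted process satisfying the equation almost surely, and any two such processes coincide for all $t\ge 0$ almost surely. *)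

(* Defs.v *)
From HB Require Import structures.
From mathcomp Require Import all_boot all_order all_algebra.
From mathcomp Require Import all_classical all_reals all_analysis.
From mathcomp Require Import complex.

Set Implicit Arguments.
Unset Strict Implicit.
Unset Printing Implicit Defensive.
Import Order.TTheory GRing.Theory Num.Theory.
Import numFieldNormedType.Exports.

Local Open Scope classical_set_scope.
Local Open Scope ring_scope.
Local Open Scope complex_scope.

Section complex_valued.
Context {R : realType}.

Definition cexp (z : R[i]) : R[i] :=
  (expR (complex.Re z))%:C * (cos (complex.Im z) +i* sin (complex.Im z)).

Context {d : measure_display} {T : measurableType d}.
Variables (mu : {measure set T -> \bar R}) (D : set T) (f : T -> R[i]).

Definition cintegrable : Prop :=
  mu.-integrable D (EFin \o (fun x => complex.Re (f x))) /\
  mu.-integrable D (EFin \o (fun x => complex.Im (f x))).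

(* Meaningful only under [cintegrable]. *)
Definition cintegral : R[i] :=
  (\int[mu]_(x in D) complex.Re (f x))%R +i*
  (\int[mu]_(x in D) complex.Im (f x))%R.

End complex_valued.

(* Processes are indexed by R, but only the times t >= 0 are ever used. *)
Section levy.
Context {R : realType} {d : measure_display} {T : measurableType d}.
Context {P : probability T R}.
Implicit Types (X : R -> {RV P >-> R}) (x gamma sigma delta : R).

Definition cadlag (f : R -> R) : Prop :=
  (forall t : R, 0 <= t -> f s @[s --> t^'+] --> f t) /\
  (forall t : R, 0 < t -> cvg (f s @[s --> t^'-])).

(* The sets B i may be the whole line, so the product rule for the whole family
   contains the one for every subfamily. *)
Definition independent_increments X : Prop :=
  forall (n : nat) (t : nat -> R) (B : nat -> set R),
    0 <= t 0%N -> (forall i, t i <= t i.+1) -> (forall i, measurable (B i)) ->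
    (P (\bigcap_(i in [set k | (k < n)%N])
          [set w | B i (X (t i.+1) w - X (t i) w)%R])
     = \prod_(i < n) P [set w | B i (X (t i.+1) w - X (t i) w)%R])%E.

Definition stationary_increments X : Prop :=
  forall (s t : R) (B : set R), 0 <= s -> 0 <= t -> measurable B ->
    P [set w | B (X (s + t) w - X s w)] = P [set w | B (X t w - X 0 w)].

Definition levy_process X x : Prop :=
  [/\ {ae P, forall w, X 0 w = x},
      independent_increments X,
      stationary_increments X &
      {ae P, forall w, cadlag (fun t => X t w)}].

Definition bounded_variation_paths X : Prop :=
  {ae P, forall w, forall t : R, 0 <= t -> bounded_variation 0 t (fun s => X s w)}.

(* Characteristic function of X_t under P_0, that is, of X_t - X_0. *)
Definition char_fun X (t l : R) : R[i] :=
  cintegral P setT (fun w => cexp (0 +i* (l * (X t w - X 0 w)))).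

(* A measure on R \ {0}, seen as a measure on R that does not charge 0. *)
Definition levy_measure (Pi : {measure set (measurableTypeR R) -> \bar R}) :
    Prop :=
  Pi [set 0] = 0%E /\
  (\int[Pi]_(y in [set~ 0%R]) (Order.min 1 (y ^+ 2))%:E < +oo)%E.

Definition levy_khintchine X gamma sigma
    (Pi : {measure set (measurableTypeR R) -> \bar R}) : Prop :=
  [/\ 0 <= sigma, levy_measure Pi &
  forall t l : R, 0 <= t ->
    char_fun X t l =
    cexp (- t%:C * (- (0 +i* (gamma * l)) + (sigma ^+ 2 * l ^+ 2 / 2)%:C
      + cintegral Pi [set~ 0%R]
          (fun y : R => 1 - cexp (0 +i* (l * y))
             + (0 +i* (l * y * \1_([set z : R | `|z| < 1]) y)))))].

(* The first clause says that the integral in the second one exists. *)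
Definition is_drift X (Pi : {measure set (measurableTypeR R) -> \bar R}) delta :
    Prop :=
  (forall l : R, cintegrable Pi [set~ 0%R]
     (fun y : R => 1 - cexp (0 +i* (l * y)))) /\
  (forall t l : R, 0 <= t ->
    char_fun X t l =
    cexp (- t%:C * (- (0 +i* (delta * l))
      + cintegral Pi [set~ 0%R] (fun y : R => 1 - cexp (0 +i* (l * y)))))).

Definition natural_filtration X (t : R) : set (set T) :=
  <<s \bigcup_(s in [set s : R | 0 <= s <= t])
        preimage_set_system setT (X s) measurable >>.

Definition adapted (F : R -> set (set T)) (Y : R -> T -> R) : Prop :=
  forall t : R, 0 <= t -> forall B : set R, measurable B -> F t (Y t @^-1` B).

(* The equation Y_t = X_t - \int_0^t h (Y_s) ds, t >= 0, the integral being
   required to exist. *)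
Definition strong_solution X (h : R -> R) (Y : R -> T -> R) : Prop :=
  adapted (natural_filtration X) Y /\
  {ae P, forall w, forall t : R, 0 <= t ->
    lebesgue_measure.-integrable `[0, t] (EFin \o (fun s => h (Y s w))) /\
    Y t w = X t w - (\int[lebesgue_measure]_(s in `[0%R, t]) h (Y s w))%R}.

Definition unique_strong_solution X (h : R -> R) : Prop :=
  (exists Y, strong_solution X h Y) /\
  (forall Y Z, strong_solution X h Y -> strong_solution X h Z ->
     {ae P, forall w, forall t : R, 0 <= t -> Y t w = Z t w}).

End levy.

Definition refraction_rate {R : realType} (alpha delta b y : R) : R :=
  if 0 <= delta <= alpha
  then alpha * \1_(`]b, +oo[) y + delta * \1_([set b]) y
  else alpha * \1_(`]b, +oo[) y.

(* Main.v *)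
(** Uniqueness is pathwise: two solutions differ by an absolutely continuous
    function, and as the rate is nondecreasing this difference decreases wherever
    it is positive.

    For existence put c = X - b and let k be the limit of the implicit Euler
    scheme for k' \in H(c - k), where H is the monotone graph obtained from the
    rate by filling its jump at 0 with [0, alpha]; the scheme converges because
    the paths have bounded variation, and Y = X - k is adapted because the scheme
    at time t only reads X at dyadic times before t. By right-continuity the
    forward slopes (k(s + h) - k(s)) / h converge to alpha where Y > b and to 0
    where Y < b. At two contact times s and s + h (Y = b) the slope of k equals
    that of X. Now the characteristic function shows that (X_h - X_0) / h tends to
    delta in law, so by stationarity of the increments and Borel-Cantelli, along
    some h_k -> 0 the slopes of X almost surely converge to delta in measure on
    bounded time intervals. Hence the slopes of k converge in mean to alpha
    1_{Y > b} + delta 1_{Y = b}, which is therefore the density of k. If delta is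
    not in [0, alpha], it is not a limit of slopes of k, so that Y = b only on a
    null set of times. *)

Require Import Defs.
From mathcomp Require Import all_boot all_order all_algebra.
From mathcomp Require Import all_classical all_reals all_analysis.
From mathcomp Require Import measurable_realfun complex ring lra.
Import Order.TTheory GRing.Theory Num.Theory.
Import numFieldNormedType.Exports.
Local Open Scope classical_set_scope.
Local Open Scope ring_scope.

Set Implicit Arguments.
Unset Strict Implicit.
Unset Printing Implicit Defensive.

(** * The implicit Euler scheme *)

Ltac minmax_free x :=
  lazymatch x with
  | context [Order.min _ _] => fail
  | context [Order.max _ _] => fail
  | _ => idtac
  end.

Ltac case_minmax :=
  repeat match goal with
  | |- context [Order.min ?x ?y] =>
      minmax_free x; minmax_free y; case: (leP x y) => ?
  | |- context [Order.max ?x ?y] =>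
      minmax_free x; minmax_free y; case: (leP x y) => ?
  end.

(* Implicit Euler step for [k' \in H (a - k)], with [H] the maximal monotone
   graph of slope 0 on the negatives, [alpha] on the positives and [[0, alpha]]
   at 0; here [r] is [alpha] times the length of the step. *)
Definition chase {R : realType} (r K a : R) : R := Num.min (K + r) (Num.max K a).

Fixpoint chase_seq {R : realType} (r : R) (c : nat -> R) (n : nat) : R :=
  if n is m.+1 then chase r (chase_seq r c m) (c m.+1) else 0.

Lemma chase_bounds {R : realType} (r K a : R) : 0 <= r ->
  K <= chase r K a <= K + r.
Proof.
by move=> r0; rewrite /chase; case_minmax; lra.
Qed.

Lemma chase_seq_bounds {R : realType} (r : R) (c : nat -> R) (i n : nat) :
  0 <= r ->
  chase_seq r c i <= chase_seq r c (i + n) <= chase_seq r c i + n%:R * r.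
Proof.
move=> r0; elim: n => [|n IH]; first by rewrite addn0 mul0r addr0 lexx.
rewrite addnS -natr1 /=.
by have := chase_bounds (chase_seq r c (i + n)) (c (i + n).+1) r0; lra.
Qed.

(** Each step either spends its whole allowance [r] or reaches its target, and the state never
    decreases. *)
Lemma chase_seq_ge {R : realType} (r a : R) (c : nat -> R) (i n : nat) :
  0 <= r -> (forall j, (i < j <= i + n)%N -> a <= c j) ->
  Num.min (chase_seq r c i + n%:R * r) a <= chase_seq r c (i + n).
Proof.
move=> r0; elim: n => [|n IH] ac.
  by rewrite addn0 mul0r addr0 ge_min lexx.
have {}IH : Num.min (chase_seq r c i + n%:R * r) a <= chase_seq r c (i + n).
  apply: IH => j /andP[ij jn]; apply: ac; rewrite ij (leq_trans jn)//.
  by rewrite leq_add2l.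
have := ac (i + n.+1)%N; rewrite addnS ltnS leq_addr leqnn => /(_ isT).
move: IH; rewrite -natr1 /= /chase.
case_minmax; lra.
Qed.

Lemma chase_seq_le {R : realType} (r a : R) (c : nat -> R) (i n : nat) :
  0 <= r -> (forall j, (i < j <= i + n)%N -> c j <= a) ->
  chase_seq r c (i + n) <= Num.max (chase_seq r c i) a.
Proof.
move=> r0; elim: n => [|n IH] ac.
  by rewrite addn0 le_max lexx.
have /IH : (forall j, (i < j <= i + n)%N -> c j <= a).
  move=> j /andP[ij jn]; apply: ac; rewrite ij (leq_trans jn)//.
  by rewrite leq_add2l.
have := ac (i + n.+1)%N; rewrite addnS ltnS leq_addr leqnn => /(_ isT) /=.
rewrite /chase; case_minmax; lra.
Qed.

(* [F'] is the state reached from [F] along targets within [v] of [a], with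
   total allowance [r]; it is compared with one step of length [r] from [C]. *)
Lemma chase_stable {R : realType} (r v a E F F' C : R) : 0 <= r -> 0 <= v ->
  F <= F' <= F + r -> Num.min (F + r) (a - v) <= F' -> F' <= Num.max F (a + v) ->
  `|F - C| <= E ->
  `|F' - chase r C a| <= E + r /\ `|F' - chase r C a| <= Num.max E v.
Proof.
move=> r0 v0; rewrite /chase.
by rewrite !ler_norml; case_minmax => *; split; lra.
Qed.

(** * The scheme on dyadic grids and its limit *)

Section chaser.
Context {R : realType}.
Implicit Types (alpha t : R) (c : R -> R).

(** The scheme of mesh [1 / 2 ^+ n], frozen between grid points. The grids are nested, so that two
    levels can be compared coarse step by coarse step. *)
Definition chaser_approx alpha c (n : nat) (t : R) : R :=
  chase_seq (alpha / 2 ^+ n) (fun j => c (j%:R / 2 ^+ n))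
    (Num.truncn (t * 2 ^+ n)).

(* The upper limit is measurable in parameters of [c] whether or not the
   approximations converge. *)
Definition chaser alpha c (t : R) : R :=
  limn_sup (fun n => chaser_approx alpha c n t).

Lemma exp2_gt0 n : 0 < 2 ^+ n :> R.
Proof. by rewrite exprn_gt0. Qed.

Lemma div_exp2_ge0 alpha n : 0 <= alpha -> 0 <= alpha / 2 ^+ n.
Proof. by move=> a0; rewrite divr_ge0// ltW// exp2_gt0. Qed.

Lemma div_exp2_cvg0 alpha : alpha / 2 ^+ n @[n --> \oo] --> (0 : R).
Proof.
rewrite -[0](mulr0 alpha); apply: cvgM; first exact: cvg_cst.
under eq_fun do rewrite -exprVn.
by apply: cvg_expr; rewrite ger0_norm ?invr_ge0// invf_lt1 ?ltr1n.
Qed.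

Lemma truncn_grid n t : 0 <= t ->
  (Num.truncn (t * 2 ^+ n))%:R / 2 ^+ n <= t
  < (Num.truncn (t * 2 ^+ n))%:R / 2 ^+ n + (2 ^+ n)^-1.
Proof.
move=> t0; have /truncn_itv : 0 <= t * 2 ^+ n.
  by rewrite mulr_ge0// ltW// exp2_gt0.
set m := Num.truncn _; rewrite ler_pdivrMr ?exp2_gt0//.
have -> : m%:R / 2 ^+ n + (2 ^+ n)^-1 = m.+1%:R / 2 ^+ n :> R.
  by rewrite -[m.+1%:R]natr1 mulrDl mul1r.
by rewrite ltr_pdivlMr ?exp2_gt0.
Qed.

Lemma truncn_le_grid n (s t : R) : 0 <= s -> s <= t ->
  (Num.truncn (s * 2 ^+ n) <= Num.truncn (t * 2 ^+ n))%N.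
Proof. by move=> s0 st; apply: le_truncn; rewrite ler_pM2r ?exp2_gt0. Qed.

(** The last term accounts for the single grid point by which the count between [s] and [t] may
    exceed [(t - s) * 2 ^+ n]. *)
Lemma chaser_approx_bounds alpha c n s t : 0 <= alpha -> 0 <= s -> s <= t ->
  chaser_approx alpha c n s <= chaser_approx alpha c n t
  <= chaser_approx alpha c n s + alpha * (t - s) + alpha / 2 ^+ n.
Proof.
move=> a0 s0 st; rewrite /chaser_approx.
have [i si] := ex_intro (fun i => i = Num.truncn (s * 2 ^+ n)) _ erefl.
have [j tj] := ex_intro (fun i => i = Num.truncn (t * 2 ^+ n)) _ erefl.
have := truncn_le_grid n s0 st.
have := truncn_grid n s0; have := truncn_grid n (le_trans s0 st).
rewrite -si -tj => tg sg ij.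
have r0 : 0 <= alpha / 2 ^+ n by rewrite divr_ge0// ltW// exp2_gt0.
have := chase_seq_bounds (fun j => c (j%:R / 2 ^+ n)) i (j - i) r0.
rewrite subnKC// natrB// => /andP[-> /le_trans]; apply.
rewrite -addrA lerD2l mulrCA -mulrDr ler_wpM2l//.
by rewrite mulrBl; lra.
Qed.

Lemma chaser_approx_ge alpha c a n s t : 0 <= alpha -> 0 <= s -> s <= t ->
  (forall u, s <= u <= t -> a <= c u) ->
  Num.min (chaser_approx alpha c n s + alpha * (t - s) - alpha / 2 ^+ n) a
  <= chaser_approx alpha c n t.
Proof.
move=> a0 s0 st ac; rewrite /chaser_approx.
have [i si] := ex_intro (fun i => i = Num.truncn (s * 2 ^+ n)) _ erefl.
have [j tj] := ex_intro (fun i => i = Num.truncn (t * 2 ^+ n)) _ erefl.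
have := truncn_le_grid n s0 st.
have := truncn_grid n s0; have := truncn_grid n (le_trans s0 st).
rewrite -si -tj => tg sg ij.
have r0 : 0 <= alpha / 2 ^+ n by rewrite divr_ge0// ltW// exp2_gt0.
have := @chase_seq_ge _ _ a (fun j => c (j%:R / 2 ^+ n)) i (j - i) r0.
rewrite subnKC// natrB// => H; apply: le_trans (H _).
  rewrite le_min2//; rewrite -addrA lerD2l mulrCA -mulrBr ler_wpM2l//.
  by rewrite mulrBl; lra.
(* An implicit step reads [c] at its right end, and the grid point after index [i] already lies
   beyond [s]; hence all targets are read in [[s, t]]. *)
move=> k /andP[ik kj]; apply: ac; apply/andP; split.
  have := ik; rewrite -(ler_nat R) -natr1 => ik'.
  have : (i%:R + 1) / 2 ^+ n <= k%:R / 2 ^+ n :> R.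
    by rewrite ler_pM2r ?invr_gt0 ?exp2_gt0.
  by rewrite mulrDl; lra.
have : k%:R / 2 ^+ n <= j%:R / 2 ^+ n :> R.
  by rewrite ler_pM2r ?invr_gt0 ?exp2_gt0// ler_nat.
lra.
Qed.

Lemma chaser_approx_le alpha c a n s t : 0 <= alpha -> 0 <= s -> s <= t ->
  (forall u, s <= u <= t -> c u <= a) ->
  chaser_approx alpha c n t <= Num.max (chaser_approx alpha c n s) a.
Proof.
move=> a0 s0 st ac; rewrite /chaser_approx.
have [i si] := ex_intro (fun i => i = Num.truncn (s * 2 ^+ n)) _ erefl.
have [j tj] := ex_intro (fun i => i = Num.truncn (t * 2 ^+ n)) _ erefl.
have := truncn_le_grid n s0 st.
have := truncn_grid n s0; have := truncn_grid n (le_trans s0 st).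
rewrite -si -tj => tg sg ij.
have r0 : 0 <= alpha / 2 ^+ n by rewrite divr_ge0// ltW// exp2_gt0.
have := @chase_seq_le _ _ a (fun j => c (j%:R / 2 ^+ n)) i (j - i) r0.
rewrite subnKC//; apply.
move=> k /andP[ik kj]; apply: ac; apply/andP; split.
  have := ik; rewrite -(ler_nat R) -natr1 => ik'.
  have : (i%:R + 1) / 2 ^+ n <= k%:R / 2 ^+ n :> R.
    by rewrite ler_pM2r ?invr_gt0 ?exp2_gt0.
  by rewrite mulrDl; lra.
have : k%:R / 2 ^+ n <= j%:R / 2 ^+ n :> R.
  by rewrite ler_pM2r ?invr_gt0 ?exp2_gt0// ler_nat.
lra.
Qed.

Lemma chaser_approx0 alpha c n : chaser_approx alpha c n 0 = 0.
Proof. by rewrite /chaser_approx mul0r truncn0. Qed.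

(* On a coarse step where [c] varies by at most [e] the error cannot exceed [e]
   unless it already did; the other steps add at most [alpha / 2 ^+ n] each, and
   the variation of [c] bounds their number. *)
Lemma chase_seq_refine alpha c (V : R -> R) (T e : R) (n p j : nat) :
  0 <= alpha -> 0 < e ->
  (forall u w, 0 <= u -> u <= w -> w <= T -> `|c u - c w| <= V w - V u) ->
  j%:R / 2 ^+ n <= T ->
  `|chase_seq (alpha / 2 ^+ (n + p)) (fun i => c (i%:R / 2 ^+ (n + p))) (j * 2 ^ p)
    - chase_seq (alpha / 2 ^+ n) (fun i => c (i%:R / 2 ^+ n)) j|
  <= e + alpha / 2 ^+ n / e * (V (j%:R / 2 ^+ n) - V 0).
Proof.
move=> a0 e0 cV; set Fs := chase_seq _ _; set Cs := chase_seq _ _.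
have r0 m : 0 <= alpha / 2 ^+ m by rewrite divr_ge0// ltW// exp2_gt0.
elim: j => [|j IH] jT.
  by rewrite mul0n /Fs /Cs/= subrr normr0 mul0r subrr mulr0 addr0 ltW.
have le_j : j%:R / 2 ^+ n <= j.+1%:R / 2 ^+ n :> R.
  by rewrite ler_pM2r ?invr_gt0 ?exp2_gt0// ler_nat.
have {IH} := IH (le_trans le_j jT).
set u := j%:R / 2 ^+ n in le_j *; set w := j.+1%:R / 2 ^+ n in le_j jT *.
have u0 : 0 <= u by rewrite divr_ge0// ltW// exp2_gt0.
set v := V w - V u.
have v0 : 0 <= v by rewrite (le_trans _ (cV u w u0 le_j jT)).
have V0 : 0 <= V u - V 0.
  by apply: le_trans (cV 0 u (lexx _) u0 (le_trans le_j jT)).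
set E := e + _ => FE.
have targets i : (j * 2 ^ p < i <= j * 2 ^ p + 2 ^ p)%N ->
    c w - v <= c (i%:R / 2 ^+ (n + p)) <= c w + v.
  move=> /andP[ji ij].
  have iu : u <= i%:R / 2 ^+ (n + p).
    rewrite /u exprD ler_pdivrMr ?exp2_gt0// -mulrA invfM.
    rewrite (mulrC _ (2 ^+ n)) mulVKf ?gt_eqF ?exp2_gt0//.
    by rewrite ler_pdivlMr ?exp2_gt0// -natrX -natrM ler_nat ltnW.
  have iw : i%:R / 2 ^+ (n + p) <= w.
    rewrite /w exprD ler_pdivlMr ?exp2_gt0// -mulrA invfM.
    rewrite (mulrC _ (2 ^+ n)) mulVKf ?gt_eqF ?exp2_gt0//.
    by rewrite ler_pdivrMr ?exp2_gt0// -natrX -natrM ler_nat mulSn addnC.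
  have i0 := le_trans u0 iu.
  have := cV _ _ u0 iu (le_trans iw jT).
  have := cV _ _ i0 iw jT.
  set z := i%:R / _.
  rewrite /v !ler_norml => /andP[? ?] /andP[z1 z2].
  have : 0 <= V z - V u by lra.
  by move=> ?; apply/andP; split; lra.
have step : (2 ^ p)%N%:R * (alpha / 2 ^+ (n + p)) = alpha / 2 ^+ n.
  rewrite natrX exprD invfM mulrCA (mulrC (2 ^+ n)^-1).
  by rewrite mulVKf ?gt_eqF ?exp2_gt0.
have := chase_seq_bounds (fun i => c (i%:R / 2 ^+ (n + p))) (j * 2 ^ p) (2 ^ p)
  (r0 (n + p)%N).
have := @chase_seq_ge _ _ (c w - v) (fun i => c (i%:R / 2 ^+ (n + p)))
  (j * 2 ^ p) (2 ^ p) (r0 (n + p)%N).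
have := @chase_seq_le _ _ (c w + v) (fun i => c (i%:R / 2 ^+ (n + p)))
  (j * 2 ^ p) (2 ^ p) (r0 (n + p)%N).
rewrite step (addnC (j * _)%N) -mulSn -/Fs => H1 H2 H3.
have /H1 {}H1 : forall i, (j * 2 ^ p < i <= j.+1 * 2 ^ p)%N ->
    c (i%:R / 2 ^+ (n + p)) <= c w + v.
  by move=> i; rewrite mulSn addnC => /targets /andP[].
have /H2 {}H2 : forall i, (j * 2 ^ p < i <= j.+1 * 2 ^ p)%N ->
    c w - v <= c (i%:R / 2 ^+ (n + p)).
  by move=> i; rewrite mulSn addnC => /targets /andP[].
have [S1 S2] := chase_stable (r0 n) v0 H3 H2 H1 FE.
rewrite [Cs _]/=.
have -> : V w - V 0 = (V u - V 0) + v by rewrite /v; ring.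
have re : 0 <= alpha / 2 ^+ n / e by rewrite divr_ge0// ltW.
have rv := mulr_ge0 re v0.
rewrite mulrDr addrA -/E.
have [ve|ev] := leP v e.
  apply: (le_trans S2); rewrite ge_max; apply/andP; split; first lra.
  have := mulr_ge0 re V0; rewrite /E; lra.
(* When [e < v], the extra [alpha / 2 ^+ n] is at most [alpha / 2 ^+ n / e * v], so the variation
   over this step pays for it. *)
apply: (le_trans S1); rewrite lerD2l.
rewrite -[leLHS]mulr1 -[leRHS]mulrA ler_wpM2l// mulrC ler_pdivlMr// mul1r.
exact: ltW.
Qed.

(** After the last coarse grid point before [t] the coarse scheme is frozen, while the fine one
    moves by at most [alpha / 2 ^+ n] for the elapsed time and as much again for rounding; this is
    the summand 2. *)
Lemma chaser_approx_near alpha c (V : R -> R) (t e : R) (n p : nat) :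
  0 <= alpha -> 0 < e -> 0 <= t ->
  (forall u w, 0 <= u -> u <= w -> w <= t -> `|c u - c w| <= V w - V u) ->
  `|chaser_approx alpha c (n + p) t - chaser_approx alpha c n t|
  <= e + alpha / 2 ^+ n * ((V t - V 0) / e + 2).
Proof.
move=> a0 e0 t0 cV.
have /andP[jt tj] := truncn_grid n t0.
set j := Num.truncn _ in jt tj.
have j0 : 0 <= j%:R / 2 ^+ n :> R by rewrite divr_ge0// ltW// exp2_gt0.
have := chase_seq_refine p a0 e0 cV jt.
have := chaser_approx_bounds c (n + p) a0 j0 jt.
have jp : j%:R / 2 ^+ n * 2 ^+ (n + p) = (j * 2 ^ p)%N%:R :> R.
  by rewrite exprD mulrA divfK ?gt_eqF ?exp2_gt0// natrM natrX.
rewrite /chaser_approx -/j jp natrK.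
set F := chase_seq _ _ _; set F' := chase_seq _ _ _; set C := chase_seq _ _ _.
have rp : alpha / 2 ^+ (n + p) <= alpha / 2 ^+ n.
  rewrite ler_wpM2l// lef_pV2 ?posrE ?exp2_gt0//.
  by rewrite ler_weXn2l ?ler1n ?leq_addr.
have : alpha * (t - j%:R / 2 ^+ n) <= alpha / 2 ^+ n.
  by rewrite ler_wpM2l//; lra.
have : alpha / 2 ^+ n / e * (V (j%:R / 2 ^+ n) - V 0)
       <= alpha / 2 ^+ n * ((V t - V 0) / e).
  rewrite -[leLHS]mulrA; apply: ler_wpM2l; first by rewrite divr_ge0// ltW// exp2_gt0.
  rewrite mulrC ler_pM2r ?invr_gt0// lerB// -subr_ge0.
  exact: le_trans (cV _ _ j0 jt (lexx t)).
rewrite [alpha / _ * (_ + 2)]mulrDr !ler_norml => *; lra.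
Qed.

(** The bound of [chaser_approx_near] is uniform in [p]: once the accuracy is fixed, a large [n]
    gives the Cauchy property. *)
Lemma chaser_approx_cvg alpha c (V : R -> R) (t : R) : 0 <= alpha -> 0 <= t ->
  (forall u w, 0 <= u -> u <= w -> w <= t -> `|c u - c w| <= V w - V u) ->
  chaser_approx alpha c n t @[n --> \oo] --> chaser alpha c t.
Proof.
move=> a0 t0 cV.
suff /cvg_ex[l ul] : cvgn (fun n => chaser_approx alpha c n t : R^o).
  have [_ lE] := cvg_limn_inf_sup ul.
  by rewrite /chaser lE.
apply/cauchy_cvgP; apply/cauchyP => e e0.
have e20 : 0 < e / 2 by lra.
have [W W0 hW] : exists2 W, 0 < W & (V t - V 0) / (e / 2) + 2 <= W.
  exists (`|(V t - V 0) / (e / 2) + 2| + 1); first by rewrite ltr_wpDl.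
  by rewrite (le_trans (ler_norm _))// lerDl.
have [n nP] : exists n, alpha / 2 ^+ n * W < e / 2.
  have /cvgrPdist_lt/(_ _ (divr_gt0 e20 W0)) [n _ nP] := div_exp2_cvg0 alpha.
  exists n; have /= := nP n (leqnn n).
  rewrite sub0r normrN ger0_norm ?div_exp2_ge0//.
  by rewrite ltr_pdivlMr// mulrC.
exists (chaser_approx alpha c n t); exists n => // m /= nm.
rewrite /ball/= distrC -(subnKC nm).
apply: (le_lt_trans (chaser_approx_near _ (m - n) a0 e20 t0 cV)).
have : alpha / 2 ^+ n * ((V t - V 0) / (e / 2) + 2) <= alpha / 2 ^+ n * W.
  by rewrite ler_wpM2l ?div_exp2_ge0.
lra.
Qed.

(** Bounded variation in the form used by the scheme: a real function, such as the running total
    variation, dominates the increments. *)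
Definition bv_path c := forall t, 0 <= t -> exists V : R -> R,
  forall u w, 0 <= u -> u <= w -> w <= t -> `|c u - c w| <= V w - V u.

Lemma bounded_variation_path c :
  (forall t, 0 <= t -> bounded_variation 0 t c) -> bv_path c.
Proof.
move=> bvc t t0; exists (fun u => fine (total_variation 0 u c)).
move=> u w u0 uw wt; have w0 := le_trans u0 uw.
have ufin : total_variation 0 u c \is a fin_num.
  exact/(bounded_variationP _ u0)/bvc.
have wfin : total_variation 0 w c \is a fin_num.
  exact/(bounded_variationP _ w0)/bvc.
rewrite -lee_fin EFinB !fineK// (total_variationD c u0 uw) addeAC subee// add0e.
by rewrite distrC total_variation_ge.
Qed.

Section limit.
Variables (alpha : R) (c : R -> R).
Hypotheses (alpha_ge0 : 0 <= alpha) (c_bv : bv_path c).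

Let cvg_chaser t : 0 <= t ->
  chaser_approx alpha c n t @[n --> \oo] --> chaser alpha c t.
Proof.
by move=> t0; have [V cV] := c_bv t0; exact: chaser_approx_cvg cV.
Qed.

Let near_chaser s t e : 0 <= s -> 0 <= t -> 0 < e -> exists n,
  [/\ `|chaser_approx alpha c n s - chaser alpha c s| < e,
      `|chaser_approx alpha c n t - chaser alpha c t| < e &
      alpha / 2 ^+ n < e].
Proof.
move=> s0 t0 e0.
have /cvgrPdist_lt/(_ _ e0) [n1 _ h1] := cvg_chaser s0.
have /cvgrPdist_lt/(_ _ e0) [n2 _ h2] := cvg_chaser t0.
have /cvgrPdist_lt/(_ _ e0) [n3 _ h3] := div_exp2_cvg0 alpha.
exists (maxn n1 (maxn n2 n3)); split.
- by rewrite distrC; apply: h1; rewrite /= leq_maxl.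
- by rewrite distrC; apply: h2; rewrite /= !leq_max leqnn orbT.
- have := h3 (maxn n1 (maxn n2 n3)); rewrite /= !leq_max leqnn !orbT => /(_ isT).
  by rewrite sub0r normrN => /(le_lt_trans (ler_norm _)).
Qed.

Lemma chaser0 : chaser alpha c 0 = 0.
Proof.
apply/eqP; rewrite -normr_le0; apply/ler_addgt0Pr => e e0; rewrite add0r.
have [n [h _ _]] := near_chaser (lexx 0) (lexx 0) e0.
by move: h; rewrite chaser_approx0 sub0r normrN => /ltW.
Qed.

Lemma chaser_bounds s t : 0 <= s -> s <= t ->
  chaser alpha c s <= chaser alpha c t <= chaser alpha c s + alpha * (t - s).
Proof.
move=> s0 st; apply/andP; split; apply/ler_addgt0Pr => e e0;
  have e30 : 0 < e / 3 by [lra];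
  have [n []] := near_chaser s0 (le_trans s0 st) e30;
  have := chaser_approx_bounds c n alpha_ge0 s0 st;
  rewrite !ltr_norml => *; lra.
Qed.

(** Passage to the limit in [chaser_approx_ge]; this gives slope [alpha] at times when [Y > b]. *)
Lemma chaser_rise a s t : 0 <= s -> s <= t ->
  (forall u, s <= u <= t -> a <= c u) ->
  chaser alpha c s + alpha * (t - s) <= a ->
  chaser alpha c t = chaser alpha c s + alpha * (t - s).
Proof.
move=> s0 st ac sa; apply/eqP; rewrite eq_le.
have /andP[_ ->] := chaser_bounds s0 st.
apply/ler_addgt0Pr => e e0; have e30 : 0 < e / 3 by [lra].
have [n []] := near_chaser s0 (le_trans s0 st) e30.
have := chaser_approx_ge n alpha_ge0 s0 st ac.
by case_minmax; rewrite !ltr_norml => *; lra.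
Qed.

(** Passage to the limit in [chaser_approx_le]; this gives slope 0 at times when [Y < b]. *)
Lemma chaser_rest a s t : 0 <= s -> s <= t ->
  (forall u, s <= u <= t -> c u <= a) -> a <= chaser alpha c s ->
  chaser alpha c t = chaser alpha c s.
Proof.
move=> s0 st ac sa; apply/eqP; rewrite eq_le.
have /andP[-> _] := chaser_bounds s0 st; rewrite andbT.
apply/ler_addgt0Pr => e e0; have e30 : 0 < e / 3 by [lra].
have [n []] := near_chaser s0 (le_trans s0 st) e30.
have := chaser_approx_le n alpha_ge0 s0 st ac.
by case_minmax; rewrite !ltr_norml => *; lra.
Qed.

End limit.
End chaser.

(** * Right-continuous paths *)

Lemma bounded_integrable {R : realType} d (T : measurableType d)
    (mu : {measure set T -> \bar R}) (D : set T) (f : T -> R) (M : R) :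
  measurable D -> (mu D < +oo)%E -> measurable_fun D f ->
  (forall x, D x -> `|f x| <= M) -> mu.-integrable D (EFin \o f).
Proof.
move=> mD Dfin mf fM; apply: measurable_bounded_integrable => //.
exists M; split; first exact: num_real.
by move=> y My x Dx /=; rewrite (le_trans (fM x Dx))// ltW.
Qed.

Lemma itvco_lty {R : realType} (a t : R) : (lebesgue_measure `[a, t[%classic < +oo)%E.
Proof. by rewrite lebesgue_measure_itv/=; case: ifP => _; rewrite ?ltry// -EFinB ltry. Qed.

Lemma itvcc_lty {R : realType} (a t : R) : (lebesgue_measure `[a, t]%classic < +oo)%E.
Proof. by rewrite lebesgue_measure_itv/=; case: ifP => _; rewrite ?ltry// -EFinB ltry. Qed.

Section right_continuous_paths.
Context {R : realType}.
Implicit Types (f : R -> R) (s t : R).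

Definition right_cont f := forall t : R, 0 <= t -> f s @[s --> t^'+] --> f t.

(** The successor places the point strictly to the right of [s], even when [s] is on the grid, as
    limits along [s^'+] require. Thus [f \o next_grid n] is a step function tending to a
    right-continuous [f]. *)
Definition next_grid (n : nat) s : R :=
  (Num.truncn (s * 2 ^+ n)).+1%:R / 2 ^+ n.

Lemma next_grid_gt n s : s < next_grid n s.
Proof. by rewrite ltr_pdivlMr ?exp2_gt0// truncnS_gt. Qed.

Lemma next_grid_le n s : 0 <= s -> next_grid n s <= s + (2 ^+ n)^-1.
Proof.
move=> s0; have /andP[h _] := truncn_grid n s0.
by rewrite /next_grid -natr1 mulrDl mul1r lerD2r.
Qed.

Lemma next_grid_cvg s : 0 <= s -> next_grid n s @[n --> \oo] --> s.
Proof.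
move=> s0; apply/cvgrPdist_le => e e0.
have /cvgrPdist_lt/(_ _ e0) [N _ hN] := div_exp2_cvg0 (1 : R).
exists N => // n /= Nn.
have := hN n Nn; rewrite sub0r normrN mul1r ltr_norml => /andP[_ ?].
have := next_grid_gt n s; have := next_grid_le n s0.
by rewrite ler_norml => *; apply/andP; split; lra.
Qed.

Lemma right_cont_next_grid f s : right_cont f -> 0 <= s ->
  f (next_grid n s) @[n --> \oo] --> f s.
Proof.
move=> rf s0; have /cvg_at_rightP := rf s s0; apply; split.
  by move=> n; exact: next_grid_gt.
exact: next_grid_cvg.
Qed.

Lemma measurable_next_grid f n :
  measurable_fun (`[0, +oo[ : set R) (f \o next_grid n).
Proof.
move=> _ /= B mB.
have -> : `[0, +oo[ `&` (f \o next_grid n) @^-1` B =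
    \bigcup_(k in [set k : nat | B (f (k.+1%:R / 2 ^+ n))])
      `[k%:R / 2 ^+ n, k.+1%:R / 2 ^+ n[%classic.
  apply/seteqP; split => [s [/= + sB]|s [k /= kB]].
    rewrite in_itv/= andbT => s0; exists (Num.truncn (s * 2 ^+ n)) => //=.
    have := truncn_grid n s0; rewrite in_itv/=.
    by rewrite -[X in _ -> _ && (_ < X / _)]natr1 mulrDl mul1r.
  rewrite in_itv/= => /andP[ks sk].
  have s0 : 0 <= s by rewrite (le_trans _ ks)// divr_ge0// ltW// exp2_gt0.
  split; first by rewrite in_itv/= s0.
  rewrite /next_grid (_ : Num.truncn _ = k)//; apply: truncn_def.
  by rewrite -ler_pdivrMr ?exp2_gt0// ks -ltr_pdivlMr ?exp2_gt0.
by apply: bigcup_measurable => k _; exact: measurable_itv.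
Qed.

Lemma right_cont_measurable f : right_cont f ->
  measurable_fun (`[0, +oo[ : set R) f.
Proof.
move=> rf; apply: (@measurable_fun_cvg _ _ _ _ (fun n => f \o next_grid n)).
  by move=> n; exact: measurable_next_grid.
move=> s /=; rewrite in_itv/= andbT => s0.
exact: right_cont_next_grid.
Qed.

Lemma right_cont_shift f h : 0 <= h -> right_cont f ->
  right_cont (fun s => f (s + h)).
Proof.
move=> h0 rf t t0; apply/cvg_at_rightP => u [ut cu].
have /cvg_at_rightP := rf (t + h) (addr_ge0 t0 h0); apply; split.
  by move=> n; rewrite ltrD2r.
by apply: cvgD => //; exact: cvg_cst.
Qed.

Lemma lebesgue_measure_shift (h : R) (A : set R) : measurable A ->
  pushforward lebesgue_measure ((fun s => s + h) : _ -> measurableTypeR R) A =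
  lebesgue_measure A.
Proof.
have mh : measurable_fun setT (fun s : R => s + h) by exact: measurable_funD.
move=> mA; apply/esym/lebesgue_measure_unique => //= _ [[a b]] _ <-; rewrite /pushforward.
rewrite (_ : _ @^-1` _ = `]a - h, b - h]%classic).
  rewrite !lebesgue_measure_itv/= !lte_fin ltrD2r.
  by case: ifP => // _; rewrite -!EFinB; congr _%:E; ring.
apply/seteqP; split => s /=; rewrite !in_itv/= => /andP[? ?]; apply/andP; split; lra.
Qed.

Lemma ge0_integral_shift (f : R -> R) (h t : R) : 0 <= h ->
  measurable_fun (`[0, +oo[ : set R) f -> (forall s, 0 <= s -> 0 <= f s) ->
  (\int[lebesgue_measure]_(s in `[0%R, t[) (f (s + h))%:E =
   \int[lebesgue_measure]_(s in `[h, (t + h)%R[) (f s)%:E)%E.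
Proof.
move=> h0 mf f0.
have mh : measurable_fun setT ((fun s => s + h) : _ -> measurableTypeR R).
  exact: measurable_funD.
transitivity (\int[pushforward lebesgue_measure
    ((fun s => s + h)%R : _ -> measurableTypeR R)]_(s in `[h, (t + h)%R[) (f s)%:E)%E;
    last first.
  by apply: eq_measure_integral => A mA _; exact/lebesgue_measure_shift.
rewrite ge0_integral_pushforward//=.
- congr (integral _ _ _).
  by apply/seteqP; split => s /=; rewrite !in_itv/= => /andP[? ?]; apply/andP; split; lra.
- apply/measurable_EFinP; apply: measurable_funS mf => //.
  by move=> s /=; rewrite !in_itv/= => /andP[? _]; rewrite andbT; lra.
- move=> s; rewrite inE/= in_itv/= => /andP[? _]; rewrite lee_fin f0//; lra.
Qed.

Lemma ge0_integral_itv_split (f : R -> \bar R) (a u v : R) : a <= u -> u <= v ->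
  measurable_fun `[a, v[ f -> (forall s, a <= s -> (0 <= f s)%E) ->
  (\int[lebesgue_measure]_(s in `[a, v[) f s =
   \int[lebesgue_measure]_(s in `[a, u[) f s +
   \int[lebesgue_measure]_(s in `[u, v[) f s)%E.
Proof.
move=> au uv mf f0.
have E : `[a, v[%classic = `[a, u[%classic `|` `[u, v[%classic :> set R.
  by rewrite -itv_bndbnd_setU// bnd_simp.
rewrite {1}E ge0_integral_setU//.
- by rewrite -E.
- by move=> s; rewrite -E /= in_itv/= => /andP[? _]; exact: f0.
- apply/disj_setPS => s [] /=; rewrite !in_itv/= => /andP[_ ?] /andP[? _]; lra.
Qed.

Lemma integral_next_grid f (n N : nat) : (forall s, 0 <= f s) ->
  (\int[lebesgue_measure]_(s in `[0%R, (N%:R / 2 ^+ n)%R[) (f (next_grid n s))%:E =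
   ((2 ^+ n)^-1 * \sum_(i < N) f (i.+1%:R / 2 ^+ n))%R%:E)%E.
Proof.
move=> f0; elim: N => [|N IH].
  by rewrite mul0r set_itvco0 integral_set0 big_ord0 mulr0.
have e0 : 0 < (2 ^+ n)^-1 :> R by rewrite invr_gt0 exp2_gt0.
have N0 : 0 <= N%:R / 2 ^+ n :> R by rewrite divr_ge0// ltW// exp2_gt0.
have NS : N%:R / 2 ^+ n <= N.+1%:R / 2 ^+ n :> R.
  by rewrite ler_pM2r// ler_nat.
have mG (D : set R) : measurable D -> D `<=` `[0, +oo[%classic ->
    measurable_fun D (fun s => (f (next_grid n s))%:E).
  move=> mD D0; apply/measurable_EFinP.
  exact: measurable_funS (measurable_next_grid f n).
rewrite (ge0_integral_itv_split N0 NS); last 2 first.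
- apply: mG => // s /=; rewrite !in_itv/= andbT => /andP[-> _] //.
- by move=> s _; rewrite lee_fin.
rewrite IH big_ord_recr/= mulrDr EFinD; congr (_ + _)%E.
rewrite (eq_integral (cst (f (N.+1%:R / 2 ^+ n))%:E)); last first.
  move=> s; rewrite inE/= in_itv/= => /andP[Ns sN].
  rewrite /next_grid (_ : Num.truncn _ = N)//; apply: truncn_def.
  by rewrite -ler_pdivrMr ?exp2_gt0// Ns -ltr_pdivlMr ?exp2_gt0.
rewrite integral_cst//= lebesgue_measure_itv/= lte_fin ltr_pM2r// ltr_nat ltnSn.
rewrite -EFinB -EFinM mulrC -mulrBl; congr (_ * _)%:E.
by rewrite -natr1 [_ + 1]addrC addrK mul1r.
Qed.

(** The sum is the integral of the step function [f \o next_grid n], and dominated convergence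
    applies. *)
Lemma riemann_sum_cvg f (M : R) (T : nat) : right_cont f ->
  (forall s, 0 <= f s <= M) ->
  ((2 ^+ n)^-1 * \sum_(i < T * 2 ^ n) f (i.+1%:R / 2 ^+ n))%:E @[n --> \oo]
  --> (\int[lebesgue_measure]_(s in `[0%R, T%:R[) (f s)%:E)%E.
Proof.
move=> rf fM.
have D0 : `[0, T%:R[%classic `<=` (`[0, +oo[%classic : set R).
  by move=> s /=; rewrite !in_itv/= => /andP[-> _].
under eq_fun => n.
  rewrite -integral_next_grid; last by move=> s; have /andP[] := fM s.
  rewrite natrM natrX mulfK ?gt_eqF ?exp2_gt0//.
  over.
have [] := @dominated_convergence _ _ _ (@lebesgue_measure R) `[0, T%:R[%classic
  (measurable_itv _) (fun n s => (f (next_grid n s))%:E) (fun s => (f s)%:E) (cst M%:E).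
- move=> n; apply/measurable_EFinP.
  exact: measurable_funS (measurable_next_grid f n).
- apply/measurable_EFinP.
  exact: measurable_funS (right_cont_measurable rf).
- apply/aeW => s /=; rewrite in_itv/= => /andP[s0 _].
  by apply: cvg_EFin; [exact: nearW|exact: right_cont_next_grid].
- by apply: (@bounded_integrable _ _ _ _ _ (cst M) `|M|) => //; exact: itvco_lty.
- apply/aeW => s n _ /=; rewrite lee_fin.
  by have /andP[h ?] := fM (next_grid n s); rewrite ger0_norm.
by [].
Qed.

End right_continuous_paths.

(** * Slopes of the chaser *)

Section sine_bounds.
Context {R : realType}.
Implicit Types x u : R.

(** The mean value theorem gives [sin x = cos u * x] with [u] between 0 and 1, where [cos] is at
    least [cos 1]. *)
Lemma sin_lower_bound x : `|x| <= 1 -> cos 1 * `|x| <= `|sin x|.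
Proof.
wlog x0 : x / 0 <= x.
  move=> H x1; have [x0|x0] := leP 0 x; first exact: H.
  by rewrite -(normrN x) -(normrN (sin x)) -sinN H ?normrN// oppr_ge0 ltW.
rewrite (ger0_norm x0) => x1; apply: le_trans (ler_norm _).
move: x0; rewrite le_eqVlt => /predU1P[<-|x0]; first by rewrite mulr0 sin0.
have dsin (v : R) : v \in `]0, x[ -> is_derive v 1 sin (cos v).
  by move=> _; exact: is_derive_sin.
have csin : {within `[0, x], continuous (@sin R)}.
  by apply: continuous_subspaceT => v; exact: continuous_sin.
have [u] := MVT x0 dsin csin.
rewrite in_itv/= => /andP[u0 ux]; rewrite sin0 !subr0 => ->.
rewrite ler_wpM2r ?ltW// ltr_cos ?in_itv/=; last 2 first.
- by have := pi_ge2 R; rewrite (ltW u0)/=; lra.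
- by have := pi_ge2 R; rewrite ler01/=; lra.
exact: lt_le_trans x1.
Qed.

Lemma one_sub_cos_ge0 x : 0 <= 1 - cos x.
Proof. by rewrite subr_ge0 cos_le1. Qed.

Lemma one_sub_cos_le2 x : 1 - cos x <= 2.
Proof. by have := cos_geN1 x; lra. Qed.

(** The half-angle formula reduces this to [sin_lower_bound]. It recovers the square of a small
    deviation from [1 - cos]. *)
Lemma one_sub_cos_lower_bound x : `|x| <= 1 ->
  cos 1 ^+ 2 / 2 * x ^+ 2 <= 1 - cos x.
Proof.
move=> x1; have x2 : `|x / 2| <= 1.
  by rewrite normrM [`|2^-1|]ger0_norm ?invr_ge0//; lra.
have -> : 1 - cos x = 2 * sin (x / 2) ^+ 2.
  have -> : cos x = cos (x / 2 + x / 2) by rewrite -splitr.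
  by rewrite cosD -!expr2 (cos2sin2 (x / 2)); ring.
have := sin_lower_bound x2.
rewrite -(ler_pXn2r (n := 2))// ?nnegrE ?mulr_ge0 ?(ltW (cos1_gt0 _))//.
rewrite exprMn !real_normK ?num_real// => H.
have -> : cos 1 ^+ 2 / 2 * x ^+ 2 = 2 * (cos 1 ^+ 2 * (x / 2) ^+ 2) :> R.
  by rewrite exprMn exprVn; field.
by rewrite ler_pM2l.
Qed.

End sine_bounds.

Lemma addr_eq_subr {R : zmodType} (v1 v2 v3 v4 : R) :
  v1 + v2 = v3 + v4 -> v1 - v3 = v4 - v2.
Proof.
by move=> E; apply/eqP; rewrite subr_eq addrAC [v4 + _]addrC -E addrK.
Qed.

(** In [slope_integral], [v] and [w] are the integrals of the chaser over intervals of length [r]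
    starting at [t] and at 0, and [k] is its value at [t]. *)
Lemma average_near {R : realFieldType} (a k r v w : R) : 0 < r ->
  k * r <= v <= (k + a * r) * r -> 0 <= w <= a * r * r ->
  `|(v - w) / r - k| <= a * r.
Proof.
move=> r0 vP wP.
have E : `|(v - w) / r - k| * r = `|v - w - k * r|.
  by rewrite -[v - w in RHS](divfK (lt0r_neq0 r0)) -mulrBl normrM (gtr0_norm r0).
by rewrite -(ler_pM2r r0) E ler_norml; lra.
Qed.

Lemma distr_le_half {R : realFieldType} (r v1 v2 v3 w : R) :
  `|v1 - v2| <= r / 2 -> w <= r / 2 -> `|v1 - v3| <= w -> `|v3 - v2| <= r.
Proof. by rewrite !ler_norml; lra. Qed.

Lemma integrableB_EFin {R : realType} d (T : measurableType d)
    (mu : {measure set T -> \bar R}) (D : set T) (f g : T -> R) :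
  measurable D -> mu.-integrable D (EFin \o f) -> mu.-integrable D (EFin \o g) ->
  mu.-integrable D (EFin \o (fun x => f x - g x)).
Proof. by move=> mD fi gi; have := integrableB mD fi gi. Qed.

Lemma ereal_cvg0_near {R : realType} (v : nat -> \bar R) (r : R) :
  v @ \oo --> 0%E -> 0 < r -> \forall k \near \oo, (v k < r%:E)%E.
Proof.
move=> /fine_cvgP[vfin /cvgrPdist_lt v0] r0.
near=> k.
have kfin : v k \is a fin_num by near: k.
rewrite -(fineK kfin) lte_fin.
have : `|0 - (fine \o v) k| < r by near: k; exact: v0.
by rewrite sub0r normrN /= => /(le_lt_trans (ler_norm _)).
Unshelve. all: by end_near. Qed.

(** * The density of the chaser along one path *)

Section path_representation.
Context {R : realType}.

Lemma right_cont_comp (g f : R -> R) : continuous g -> right_cont f ->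
  right_cont (g \o f).
Proof. by move=> cg rf t t0; exact: (cvg_comp _ _ (rf t t0) (cg _)). Qed.

Lemma right_contB (f g : R -> R) : right_cont f -> right_cont g ->
  right_cont (fun s => f s - g s).
Proof. by move=> rf rg t t0; apply: cvgB; [exact: rf|exact: rg]. Qed.

Lemma right_cont_slope (f : R -> R) h : 0 <= h -> right_cont f ->
  right_cont (fun s => (f (s + h) - f s) / h).
Proof.
move=> h0 rf t t0; apply: cvgM; last exact: cvg_cst.
apply: cvgB; last exact: rf.
exact: (right_cont_shift h0 rf).
Qed.

Lemma right_cont_near (f : R -> R) s e : right_cont f -> 0 <= s -> 0 < e ->
  exists2 d, 0 < d & forall u, s <= u < s + d -> `|f u - f s| < e.
Proof.
move=> rf s0 e0.
have /cvgrPdist_lt/(_ _ e0) [d /= d0 H] := rf s s0.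
exists d => // u /andP[]; rewrite le_eqVlt => /predU1P[->|su usd].
  by rewrite subrr normr0.
rewrite distrC; apply: H => //=.
by rewrite ltr0_norm ?subr_lt0//; lra.
Qed.

Variables (alpha delta : R) (c : R -> R).
Hypotheses (alpha_gt0 : 0 < alpha) (c_rc : right_cont c) (c_bv : bv_path c).

Let alpha_ge0 := ltW alpha_gt0.
Let K := chaser alpha c.
Let y (s : R) : R := c s - K s.

Lemma chaser_right_cont : right_cont K.
Proof.
move=> t t0; apply/cvgrPdist_le => e e0.
have d0 : 0 < e / alpha by rewrite divr_gt0.
exists (e / alpha) => //= u; rewrite /= distrC => ud tu.
have /andP[] := chaser_bounds alpha_ge0 c_bv t0 (ltW tu).
rewrite -/K => K1 K2.
have : alpha * (u - t) <= e.
  rewrite mulrC -ler_pdivlMr//; move: ud.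
  by rewrite ger0_norm ?subr_ge0 ?(ltW tu)// => /ltW.
rewrite ler_norml; lra.
Qed.

Let y_rc : right_cont y := right_contB c_rc chaser_right_cont.

Variable h : nat -> R.
Hypotheses (h_gt0 : forall k, 0 < h k) (h_cvg0 : h k @[k --> \oo] --> 0).

Let h_ge0 k : 0 <= h k := ltW (h_gt0 k).
(** [M] bounds the distance between a slope of [K] and its expected limit, so the factor [l] brings
    the arguments of [1 - cos] into [[-1, 1]], where it dominates a multiple of the square. *)
Let M := alpha + `|delta|.
Let l := M^-1.

(** The slopes of [c] may be unbounded, so their deviation from [delta] is tested with a bounded
    function whose mean a characteristic function provides. *)
Hypothesis c_slope : forall T : nat,
  (\int[lebesgue_measure]_(s in `[0%R, T%:R[)
     (1 - cos (l * ((c (s + h k) - c s) / h k - delta)))%:E)%E @[k --> \oo]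
  --> 0%E.

Let q k (s : R) : R := (K (s + h k) - K s) / h k.
(** The expected density of [K] as a function of [Y - b]; its value at 0 is [delta] even when
    [delta] lies outside [[0, alpha]]. *)
Let G (v : R) : R := alpha * \1_(`]0, +oo[) v + delta * \1_([set 0]) v.
Let e k (s : R) : R := `|q k s - G (y s)|.

Let M_gt0 : 0 < M. Proof. by rewrite ltr_wpDr. Qed.

Let q_bounds k (s : R) : 0 <= s -> 0 <= q k s <= alpha.
Proof.
move=> s0; have ss : s <= s + h k by rewrite lerDl.
have /andP[] := chaser_bounds alpha_ge0 c_bv s0 ss; rewrite -/K => K1 K2.
rewrite divr_ge0 ?subr_ge0//= ler_pdivrMr//; move: K2; rewrite addrAC subrr add0r.
lra.
Qed.

Let G_cases (v : R) : [\/ 0 < v /\ G v = alpha, v < 0 /\ G v = 0 | v = 0 /\ G v = delta].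
Proof.
have E1 : \1_(`]0%R, +oo[%classic) v = (0 < v)%R%:R :> R.
  by rewrite indicE mem_setE in_itv/= andbT.
have E2 : \1_([set 0]) v = (v == 0)%R%:R :> R.
  by rewrite indicE; congr (_%:R); congr nat_of_bool; apply/idP/eqP; rewrite inE.
rewrite /G E1 E2; have [v0|v0|->] := ltgtP v 0.
- by apply: Or32; rewrite !mulr0 addr0.
- by apply: Or31; rewrite mulr0 mulr1 addr0.
- by apply: Or33; rewrite mulr0 mulr1 add0r.
Qed.

Let e_le k (s : R) : 0 <= s -> e k s <= M.
Proof.
move=> s0; have /andP[q0 qa] := q_bounds k s0; rewrite /e /M.
have := ler_norm delta; have := ler_norm (- delta); rewrite normrN => d1 d2.
by case: (G_cases (y s)) => -[_ ->]; rewrite ler_norml; lra.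
Qed.

(** The level [c s - y s / 2] is halfway between [c s] and [K s]. For small [h k], right-continuity
    keeps [c] on its side of that level, and [K] is too slow to cross it from below, so
    [chaser_rise] or [chaser_rest] gives the exact slope. *)
Let e_eventually0 (s : R) : 0 <= s -> y s != 0 -> \forall k \near \oo, e k s = 0.
Proof.
move=> s0 ys.
have y20 : 0 < `|y s| / 2 by rewrite divr_gt0// normr_gt0.
have [d d0 cd] := right_cont_near c_rc s0 y20.
have e0 : 0 < Num.min d (`|y s| / 2 / alpha) by rewrite lt_min d0 divr_gt0.
have /cvgrPdist_lt/(_ _ e0) [N _ hN] := h_cvg0.
exists N => // k /= /hN; rewrite sub0r normrN (gtr0_norm (h_gt0 k)).
rewrite lt_min ltr_pdivlMr// => /andP[hd hy].
have ss : s <= s + h k by rewrite lerDl.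
have c_near (u : R) : s <= u <= s + h k -> `|c u - c s| < `|y s| / 2.
  by move=> /andP[su uh]; apply: cd; rewrite su; lra.
rewrite /e; case: (G_cases (y s)) => -[ys0 ->].
- rewrite (gtr0_norm ys0) in hy c_near.
  rewrite /q /K (@chaser_rise _ _ _ alpha_ge0 c_bv (c s - y s / 2) _ _ s0 ss).
  + by rewrite addrAC subrr add0r addrAC subrr add0r mulfK ?subrr ?normr0// gt_eqF.
  + by move=> u /c_near; rewrite ltr_norml; lra.
  + by move: hy; rewrite /y -/K [s + _]addrC addrK; lra.
- rewrite (ltr0_norm ys0) in hy c_near.
  rewrite /q /K (@chaser_rest _ _ _ alpha_ge0 c_bv (c s - y s / 2) _ _ s0 ss).
  + by rewrite subrr mul0r subrr normr0.
  + by move=> u /c_near; rewrite ltr_norml; lra.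
  + by move: ys0; rewrite /y -/K; lra.
- by rewrite ys0 eqxx in ys.
Qed.

(** Removing 0 makes the indicators of these sets tend to 0 at every point. *)
Let S (m : nat) : set R := [set v | 0 < `|v| < m.+1%:R^-1].

Let u (eta : R) (m k : nat) (s : R) : R :=
  \1_(~` [set 0]) (y s) * e k s +
  M ^+ 2 / eta * (\1_([set 0]) (y s) * \1_([set v | m.+1%:R^-1 <= `|v|]) (y (s + h k))).

Let phi k (s : R) : R := 1 - cos (l * ((c (s + h k) - c s) / h k - delta)).

Let C0 := 2 / (cos 1 ^+ 2 * l ^+ 2).

Let C0_ge0 : 0 <= C0.
Proof. by rewrite divr_ge0// mulr_ge0 ?sqr_ge0. Qed.

Let phi_ge0 k (s : R) : 0 <= phi k s. Proof. exact: one_sub_cos_ge0. Qed.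

(* Off the contact set [y = 0] the slopes converge pointwise, which [u] records.
   When both [s] and [s + h k] are contact times, the slope of [K] is that of
   [c], whose distance to [delta] is controlled by [phi]; the other contact
   times either fall in the vanishing part of [u] or have [y (s + h k)] in the
   shrinking set [S m]. *)
Let e_bound (eta : R) m k (s : R) : 0 < eta -> 0 <= s ->
  e k s <= eta + u eta m k s + C0 / eta * phi k s
           + M ^+ 2 / eta * \1_(S m) (y (s + h k)).
Proof.
move=> eta0 s0.
have i0 (B : set R) (v : R) : 0 <= \1_B v :> R by [].
have iT (B : set R) (v : R) : B v -> \1_B v = 1 :> R.
  by move=> Bv; rewrite indicE mem_set.
have iF (B : set R) (v : R) : ~ B v -> \1_B v = 0 :> R.
  by move=> Bv; rewrite indicE memNset.
have Me : 0 <= M ^+ 2 / eta by rewrite divr_ge0 ?sqr_ge0// ltW.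
have Cphi : 0 <= C0 / eta * phi k s by rewrite mulr_ge0// divr_ge0// ltW.
have MS : 0 <= M ^+ 2 / eta * \1_(S m) (y (s + h k)) by rewrite mulr_ge0.
(* [phi] controls only the square of the error, hence this trade of [v] for its square. *)
have amgm (v : R) : 0 <= v -> v <= eta + v ^+ 2 / eta.
  move=> v0; have [|ev] := leP v eta.
    by have : 0 <= v ^+ 2 / eta by [rewrite divr_ge0 ?sqr_ge0// ltW]; lra.
  have : v <= v ^+ 2 / eta by rewrite ler_pdivlMr// expr2 ler_wpM2l// ltW.
  lra.
have e0 : 0 <= e k s by exact: normr_ge0.
rewrite /u; have [ys|ys] := eqVneq (y s) 0; last first.
  rewrite (iT (~` _)); last exact/eqP.
  rewrite (iF [set 0]); last exact/eqP.
  by rewrite mul0r mulr0; lra.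
rewrite (iF (~` _)); last by move=> /(_ ys).
rewrite (iT [set 0])// mul0r mul1r add0r.
have eE : e k s = `|q k s - delta|.
  rewrite /e; case: (G_cases (y s)) => -[ys' ->] //; lra.
have := amgm _ e0.
have : e k s ^+ 2 / eta <= M ^+ 2 / eta.
  by rewrite ler_pM2r ?invr_gt0// ler_sqr ?nnegrE ?(ltW M_gt0)//; exact: e_le.
have [yh|yh] := eqVneq (y (s + h k)) 0; last first.
  have [mh|mh] := leP m.+1%:R^-1 `|y (s + h k)|.
    rewrite (iT [set _ | _])//; lra.
  rewrite (iT (S m)); last by rewrite /S/= normr_gt0 yh.
  have := i0 [set v | m.+1%:R^-1 <= `|v|] (y (s + h k)).
  move=> /(mulr_ge0 Me); lra.
move=> _; have qE : q k s = (c (s + h k) - c s) / h k.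
  by move/subr0_eq: yh => ->; move/subr0_eq: ys => ->.
have := mulr_ge0 Me (i0 [set v | m.+1%:R^-1 <= `|v|] (y (s + h k))).
have : e k s ^+ 2 / eta <= C0 / eta * phi k s.
  rewrite [leRHS]mulrAC ler_pM2r ?invr_gt0//.
  have lM : `|l * (q k s - delta)| <= 1.
    rewrite normrM (gtr0_norm (_ : 0 < l)) ?invr_gt0// -eE.
    by rewrite mulrC ler_pdivrMr// mul1r; exact: e_le.
  have := one_sub_cos_lower_bound lM.
  rewrite {2}qE -/(phi k s) exprMn mulrA => H.
  have cl : 0 < cos 1 ^+ 2 * l ^+ 2 :> R.
    by rewrite mulr_gt0// exprn_gt0 ?cos1_gt0 ?invr_gt0.
  rewrite eE real_normK ?num_real// /C0 mulrAC ler_pdivlMr//.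
  have -> : (q k s - delta) ^+ 2 * (cos 1 ^+ 2 * l ^+ 2) =
    2 * (cos 1 ^+ 2 / 2 * l ^+ 2 * (q k s - delta) ^+ 2) by field.
  by rewrite ler_pM2l.
lra.
Qed.

Let mS m : measurable (S m).
Proof.
have -> : S m = (fun v : R => `|v|) @^-1` (`]0, m.+1%:R^-1[%classic : set R).
  by apply/seteqP; split => v /=; rewrite in_itv.
rewrite -[X in measurable X]setTI; exact: normr_measurable.
Qed.

Let mB (m : nat) : measurable [set v : R | m.+1%:R^-1 <= `|v|].
Proof.
have -> : [set v : R | m.+1%:R^-1 <= `|v|] =
    (fun v : R => `|v|) @^-1` (`[m.+1%:R^-1, +oo[%classic : set R).
  by apply/seteqP; split => v /=; rewrite in_itv/= andbT.
rewrite -[X in measurable X]setTI; exact: normr_measurable.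
Qed.

Let mG : measurable_fun setT G.
Proof.
apply: measurable_funD; apply: measurable_funM => //;
  by apply: measurable_indic => //; exact: measurable_itv.
Qed.

Let my : measurable_fun (`[0, +oo[ : set R) y.
Proof. exact: right_cont_measurable. Qed.

Let my_shift k : measurable_fun (`[0, +oo[ : set R) (fun s => y (s + h k)).
Proof. by apply: right_cont_measurable; exact: right_cont_shift. Qed.

Let mq k : measurable_fun (`[0, +oo[ : set R) (q k).
Proof.
by apply: right_cont_measurable; apply: right_cont_slope => //; exact: chaser_right_cont.
Qed.

Let me_ k : measurable_fun (`[0, +oo[ : set R) (e k).
Proof.
apply: measurableT_comp => //; apply: measurable_funB; first exact: mq.
exact: (measurableT_comp mG my).
Qed.

Let phi_rc k : right_cont (phi k).
Proof.
apply: (@right_cont_comp (fun v => 1 - cos (l * (v - delta)))); last exact: right_cont_slope.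
move=> v; apply: cvgB; first exact: cvg_cst.
have lv : l * (w - delta) @[w --> v] --> l * (v - delta).
  apply: cvgM; first exact: cvg_cst.
  by apply: cvgB => //; exact: cvg_cst.
exact: (cvg_comp _ _ lv (@continuous_cos R _)).
Qed.

Let mu_ eta m k : measurable_fun (`[0, +oo[ : set R) (u eta m k).
Proof.
apply: measurable_funD.
  apply: measurable_funM; last exact: me_.
  by apply: (measurableT_comp _ my); apply: measurable_indic; apply: measurableC.
apply: measurable_funM => //; apply: measurable_funM.
  by apply: (measurableT_comp _ my); exact: measurable_indic.
by apply: (measurableT_comp _ (my_shift k)); apply: measurable_indic.
Qed.

Let u_ge0 (eta : R) m k s : 0 < eta -> 0 <= u eta m k s.
Proof.
move=> eta0; apply: addr_ge0; first by apply: mulr_ge0 => //; exact: normr_ge0.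
by apply: mulr_ge0; [rewrite divr_ge0 ?sqr_ge0// ltW|exact: mulr_ge0].
Qed.

Let itv_sub (T : R) : `[0, T[%classic `<=` (`[0, +oo[%classic : set R).
Proof. by move=> s /=; rewrite !in_itv/= => /andP[-> _]. Qed.

(** Dominated convergence: off the contact set [e_eventually0] applies, and at a contact time
    right-continuity eventually forces [y (s + h k)] below [m.+1%:R^-1] in absolute value. *)
Let int_u (eta : R) m (T : R) : 0 < eta ->
  (\int[lebesgue_measure]_(s in `[0%R, T[) (u eta m k s)%:E)%E @[k --> \oo] --> 0%E.
Proof.
move=> eta0; rewrite -(integral0 lebesgue_measure `[0, T[%classic).
have Me : 0 <= M ^+ 2 / eta by rewrite divr_ge0 ?sqr_ge0// ltW.
have [] := @dominated_convergence _ _ _ (@lebesgue_measure R) `[0, T[%classic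
  (measurable_itv _) (fun k s => (u eta m k s)%:E) (cst 0%E) (cst (M + M ^+ 2 / eta)%:E).
- move=> k; apply/measurable_EFinP; exact: measurable_funS (mu_ _ _ _).
- exact: measurable_cst.
- apply/aeW => s /=; rewrite in_itv/= => /andP[s0 _].
  apply: cvg_near_cst.
  have [ys|ys] := eqVneq (y s) 0; last first.
    have := e_eventually0 s0 ys; apply: filterS => k ek; rewrite /u ek mulr0.
    by rewrite [\1_([set 0]) _]indicE memNset ?mul0r ?mulr0 ?addr0//; exact/eqP.
  have mp : 0 < m.+1%:R^-1 :> R by [].
  have [d d0 yd] := right_cont_near y_rc s0 mp.
  have /cvgrPdist_lt/(_ _ d0) := h_cvg0.
  apply: filterS => k; rewrite sub0r normrN (gtr0_norm (h_gt0 k)) => hd.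
  rewrite /u [\1_(~` _) _]indicE memNset; last by move=> /(_ ys).
  rewrite [\1_([set _ | _]) _]indicE memNset ?mul0r ?mulr0 ?addr0//=.
  apply/negP; rewrite -ltNge -[y (s + h k)]subr0 -ys; apply: yd.
  by rewrite lerDl h_ge0/= ltrD2l.
- apply: (@bounded_integrable _ _ _ _ _ (cst (M + M ^+ 2 / eta)) (M + M ^+ 2 / eta)) => //.
    exact: itvco_lty.
  by move=> s _ /=; rewrite ger0_norm// addr_ge0// ltW.
- apply/aeW => s k /=; rewrite in_itv/= => /andP[s0 _].
  rewrite lee_fin ger0_norm ?u_ge0//; apply: lerD.
    rewrite -[leRHS]mul1r; apply: ler_pM => //; first exact: normr_ge0.
    exact: e_le.
  rewrite -[leRHS]mulr1; apply: ler_wpM2l => //.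
by [].
Qed.

Let mSy m : measurable_fun (`[0, +oo[ : set R) (fun s => \1_(S m) (y s) : R).
Proof. by apply: (measurableT_comp _ my); exact: measurable_indic. Qed.

Let mSy_shift m k :
  measurable_fun (`[0, +oo[ : set R) (fun s => \1_(S m) (y (s + h k)) : R).
Proof. by apply: (measurableT_comp _ (my_shift k)); exact: measurable_indic. Qed.

Let int_S (T : R) :
  (\int[lebesgue_measure]_(s in `[0%R, T[) (\1_(S m) (y s))%:E)%E @[m --> \oo] --> 0%E.
Proof.
rewrite -(integral0 lebesgue_measure `[0, T[%classic).
have [] := @dominated_convergence _ _ _ (@lebesgue_measure R) `[0, T[%classic
  (measurable_itv _) (fun m s => (\1_(S m) (y s))%:E) (cst 0%E) (cst 1%:E).
- by move=> m; apply/measurable_EFinP; apply: measurable_funS (@mSy m).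
- exact: measurable_cst.
- apply/aeW => s _; apply: cvg_near_cst.
  have [ys|ys] := eqVneq (y s) 0.
    apply: nearW => m; rewrite indicE memNset// /S/= ys normr0 ltxx//.
  have ys0 : 0 < `|y s| by rewrite normr_gt0.
  have := near_infty_natSinv_lt (PosNum ys0); apply: filterS => m /= ym.
  by rewrite indicE memNset// /S/= => /andP[_]; rewrite ltNge ltW.
- apply: (@bounded_integrable _ _ _ _ _ (cst 1) 1) => //; first exact: itvco_lty.
  by move=> s _ /=; rewrite normr1.
- by apply/aeW => s m _ /=; rewrite lee_fin ger0_norm.
by [].
Qed.

(** A translation removes [h k] from the integrand at the price of a longer interval, so that [m]
    can be chosen before [k]. *)
Let int_S_shift m k (T : nat) : h k <= 1 ->
  (\int[lebesgue_measure]_(s in `[0%R, T%:R[) (\1_(S m) (y (s + h k)))%:E <=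
   \int[lebesgue_measure]_(s in `[0%R, T.+1%:R[) (\1_(S m) (y s))%:E)%E.
Proof.
move=> h1.
rewrite (@ge0_integral_shift _ (fun s => \1_(S m) (y s)))//.
apply: ge0_subset_integral => //=.
- by apply/measurable_EFinP; apply: measurable_funS (@mSy m).
- move=> s /=; rewrite !in_itv/= -natr1 => /andP[hs sT]; apply/andP; split.
    exact: le_trans hs.
  by rewrite (lt_le_trans sT)// lerD2l.
Qed.

(** Integrate [e_bound], fixing first [eta], then [m] by [int_S], and [k] last; each of the four
    terms contributes at most [r / 4]. *)
Lemma slope_L1_cvg (T : nat) (r : R) : 0 < r -> \forall k \near \oo,
  (\int[lebesgue_measure]_(s in `[0%R, T%:R[) (e k s)%:E <= r%:E)%E.
Proof.
move=> r0; pose eta := r / 4 / T.+1%:R.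
have eta0 : 0 < eta by rewrite !divr_gt0.
have etaT : eta * T%:R <= r / 4.
  by rewrite /eta mulrAC ler_pdivrMr// ler_wpM2l ?ler_nat// divr_ge0// ltW.
have Me : 0 < M ^+ 2 / eta by rewrite divr_gt0// exprn_gt0.
have Ce : 0 <= C0 / eta by rewrite divr_ge0// ltW.
have rM : 0 < r / 4 / (M ^+ 2 / eta) by do 2!apply: divr_gt0 => //.
have [m _ /(_ m (leqnn m)) Im] := ereal_cvg0_near (int_S T.+1%:R) rM.
have rC : 0 < r / 4 / (C0 / eta + 1).
  by apply: divr_gt0; [exact: divr_gt0|exact: ltr_wpDl].
near=> k.
have hk : h k <= 1.
  near: k; have /cvgrPdist_lt/(_ _ ltr01) := h_cvg0.
  apply: filterS => k; rewrite sub0r normrN => /ltW /(le_trans _); apply.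
  exact: ler_norm.
have Iu : (\int[lebesgue_measure]_(s in `[0%R, T%:R[) (u eta m k s)%:E < (r / 4)%:E)%E.
  by near: k; apply: (ereal_cvg0_near (int_u m T%:R eta0)); rewrite divr_gt0.
have Ip : (\int[lebesgue_measure]_(s in `[0%R, T%:R[) (phi k s)%:E <
    (r / 4 / (C0 / eta + 1))%:E)%E.
  by near: k; apply: (ereal_cvg0_near (c_slope T)).
have mDu : measurable_fun (`[0, T%:R[%classic : set R) (u eta m k).
  by apply: measurable_funS (mu_ _ _ _).
have mDphi : measurable_fun (`[0, T%:R[%classic : set R) (phi k).
  have mphi := right_cont_measurable (@phi_rc k); exact: measurable_funS mphi.
have mDS : measurable_fun (`[0, T%:R[%classic : set R) (fun s => \1_(S m) (y (s + h k)) : R).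
  by apply: measurable_funS (mSy_shift m k).
have mDe : measurable_fun (`[0, T%:R[%classic : set R) (e k).
  by apply: measurable_funS (me_ k).
pose g1 (s : R) : \bar R := (eta + u eta m k s)%:E.
pose g2 (s : R) : \bar R := ((C0 / eta)%:E * (phi k s)%:E)%E.
pose g3 (s : R) : \bar R := ((M ^+ 2 / eta)%:E * (\1_(S m) (y (s + h k))%R)%:E)%E.
apply: (@le_trans _ _ (\int[lebesgue_measure]_(s in `[0%R, T%:R[) (g1 s + g2 s + g3 s))%E).
  apply: ge0_le_integral => //.
  - by move=> s _; rewrite lee_fin normr_ge0.
  - exact/measurable_EFinP.
  - apply: emeasurable_funD; first apply: emeasurable_funD.
    + by apply/measurable_EFinP; exact: measurable_funD.
    + by apply: emeasurable_funM => //; exact/measurable_EFinP.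
    + by apply: emeasurable_funM => //; exact/measurable_EFinP.
  - move=> s /=; rewrite in_itv/= => /andP[s0 _].
    by rewrite /g1 /g2 /g3 -!EFinM -!EFinD lee_fin; exact: e_bound.
have g10 s : (0 <= g1 s)%E by rewrite lee_fin addr_ge0 ?u_ge0// ltW.
have g20 s : (0 <= g2 s)%E by rewrite /g2 -EFinM lee_fin mulr_ge0.
have g30 s : (0 <= g3 s)%E by rewrite /g3 -EFinM lee_fin mulr_ge0// ltW.
have mg1 : measurable_fun (`[0, T%:R[%classic : set R) g1.
  by apply/measurable_EFinP; exact: measurable_funD.
have mg2 : measurable_fun (`[0, T%:R[%classic : set R) g2.
  by apply: emeasurable_funM => //; exact/measurable_EFinP.
have mg3 : measurable_fun (`[0, T%:R[%classic : set R) g3.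
  by apply: emeasurable_funM => //; exact/measurable_EFinP.
rewrite ge0_integralD//; last 2 first.
- by move=> s _; rewrite adde_ge0.
- exact: emeasurable_funD.
rewrite ge0_integralD//.
have -> : (r = r / 2 + r / 4 + r / 4)%R by field.
rewrite !EFinD; apply: leeD; first apply: leeD.
- rewrite /g1; under eq_integral do rewrite EFinD.
  rewrite ge0_integralD//; last 3 first.
  + by move=> s _; rewrite lee_fin ltW.
  + by move=> s _; rewrite lee_fin u_ge0.
  + exact/measurable_EFinP.
  rewrite integral_cst//= lebesgue_measure_itv/= lte_fin.
  have -> : (r / 2 = r / 4 + r / 4)%R by field.
  rewrite EFinD; apply: leeD; last exact: ltW.
  case: ifP => _; last by rewrite mule0 lee_fin divr_ge0// ltW.
  by rewrite sube0 -EFinM lee_fin.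
- rewrite ge0_integralZl//; [|exact/measurable_EFinP|by move=> s _; rewrite lee_fin phi_ge0].
  apply: (@le_trans _ _ ((C0 / eta)%:E * (r / 4 / (C0 / eta + 1))%:E)%E).
    by apply: lee_wpmul2l; [rewrite lee_fin|exact: ltW].
  rewrite -EFinM lee_fin mulrCA -[leRHS]mulr1 ler_wpM2l ?divr_ge0 ?(ltW r0)//.
  by rewrite ler_pdivrMr ?mul1r ?lerDl// ltr_wpDl.
- rewrite ge0_integralZl//; [|exact/measurable_EFinP|by rewrite lee_fin ltW].
  apply: (@le_trans _ _ ((M ^+ 2 / eta)%:E * (r / 4 / (M ^+ 2 / eta))%:E)%E).
    apply: lee_wpmul2l; first by rewrite lee_fin ltW.
    exact: le_trans (int_S_shift m T hk) (ltW Im).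
  by rewrite -EFinM lee_fin mulrC divfK// gt_eqF.
Unshelve. all: by end_near. Qed.

Let chaser_ge0 (s : R) : 0 <= s -> 0 <= K s.
Proof.
move=> s0; have /andP[] := chaser_bounds alpha_ge0 c_bv (lexx 0) s0.
by rewrite /K chaser0.
Qed.

Let chaser_le (s : R) : 0 <= s -> K s <= alpha * s.
Proof.
move=> s0; have /andP[_] := chaser_bounds alpha_ge0 c_bv (lexx 0) s0.
by rewrite /K chaser0// subr0 add0r.
Qed.

Let mK := right_cont_measurable chaser_right_cont.

Let iK (a t : R) : 0 <= a ->
  lebesgue_measure.-integrable `[a, t[ (EFin \o K).
Proof.
move=> a0; apply: (@bounded_integrable _ _ _ _ _ _ (alpha * t)) => //.
- exact: itvco_lty.
- by apply: measurable_funS mK => // s /=; rewrite !in_itv/= andbT => /andP[/(le_trans a0)].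
- move=> s /=; rewrite in_itv/= => /andP[sa st]; have s0 := le_trans a0 sa.
  by rewrite ger0_norm ?chaser_ge0// (le_trans (chaser_le s0))// ler_wpM2l// ltW.
Qed.

Let iK_shift k (t : R) :
  lebesgue_measure.-integrable `[0, t[ (EFin \o (fun s => K (s + h k))).
Proof.
apply: (@bounded_integrable _ _ _ _ _ _ (alpha * (t + h k))) => //.
- exact: itvco_lty.
- have mKh := right_cont_measurable (right_cont_shift (h_ge0 k) chaser_right_cont).
  exact: measurable_funS mKh.
- move=> s /=; rewrite in_itv/= => /andP[s0 st].
  have s0' : 0 <= s + h k by rewrite addr_ge0.
  rewrite ger0_norm ?chaser_ge0// (le_trans (chaser_le s0'))// ler_wpM2l//.
  by rewrite lerD2r ltW.
Qed.

Let Rintegral_itvco_cst (r a t : R) : a <= t ->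
  (\int[lebesgue_measure]_(s in `[a, t[) r)%R = r * (t - a).
Proof.
move=> at_; rewrite Rintegral_cst//= lebesgue_measure_itv/= lte_fin.
case: ltP => [_|ta]; first by rewrite -EFinB.
by have -> : t = a by [apply/eqP; rewrite eq_le at_ ta]; rewrite subrr.
Qed.

Let i_cst (r a t : R) : lebesgue_measure.-integrable `[a, t[ (EFin \o (fun=> r)).
Proof.
by apply: (@bounded_integrable _ _ _ _ _ (fun=> r) `|r|) => //; exact: itvco_lty.
Qed.

(** The integral telescopes to the mean of [K] over [[t, t + h k[] minus its mean over [[0, h k[].
    As [K] has slopes in [[0, alpha]] and starts at 0, these are within [alpha * h k] above [K t]
    and above 0. *)
Lemma slope_integral k (t : R) : 0 <= t ->
  `|(\int[lebesgue_measure]_(s in `[0%R, t[) q k s)%R - K t| <= alpha * h k.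
Proof.
move=> t0; have th : t <= t + h k by rewrite lerDl.
have h0 := h_ge0 k.
have shiftE : (\int[lebesgue_measure]_(s in `[0%R, t[) K (s + h k))%R
    + (\int[lebesgue_measure]_(s in `[0%R, h k[) K s)%R =
    (\int[lebesgue_measure]_(s in `[0%R, t[) K s)%R
    + (\int[lebesgue_measure]_(s in `[t, (t + h k)%R[) K s)%R.
  have fK a v : 0 <= a ->
      (\int[lebesgue_measure]_(s in `[a, v[) (K s)%:E)%E \is a fin_num.
    by move=> a0; apply: integrable_fin_num => //; exact: iK.
  have fKh : (\int[lebesgue_measure]_(s in `[0%R, t[) (K (s + h k))%:E)%E \is a fin_num.
    by apply: integrable_fin_num => //; exact: iK_shift.
  rewrite /Rintegral -(fineD fKh (fK _ _ (lexx 0))).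
  rewrite -(fineD (fK _ _ (lexx 0)) (fK _ _ t0)); congr fine.
  have mEK (v : R) : measurable_fun (`[0, v[%classic : set R) (EFin \o K).
    by apply/measurable_EFinP; apply: measurable_funS mK.
  have EK0 s : 0 <= s -> (0 <= (K s)%:E)%E by rewrite lee_fin => /chaser_ge0.
  rewrite (@ge0_integral_shift _ K (h k) t h0 mK chaser_ge0).
  have S1 := @ge0_integral_itv_split _ (EFin \o K) 0 (h k) (t + h k) h0.
  have S2 := @ge0_integral_itv_split _ (EFin \o K) 0 t (t + h k) t0 th.
  rewrite addeC -S1; [exact: S2|by rewrite lerDr|exact: mEK|exact: EK0].
have -> : (\int[lebesgue_measure]_(s in `[0%R, t[) q k s)%R =
    ((\int[lebesgue_measure]_(s in `[t, (t + h k)%R[) K s)%R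
     - (\int[lebesgue_measure]_(s in `[0%R, h k[) K s)%R) / h k.
  rewrite RintegralZr//=; last first.
    by apply: integrableB_EFin => //; exact: iK.
  rewrite RintegralB//; last exact: iK.
  by rewrite (addr_eq_subr shiftE).
have I1 : K t * h k <= (\int[lebesgue_measure]_(s in `[t, (t + h k)%R[) K s)%R
    <= (K t + alpha * h k) * h k.
  have cstE (v : R) : v * h k = (\int[lebesgue_measure]_(s in `[t, (t + h k)%R[) v)%R.
    by rewrite Rintegral_itvco_cst// addrAC subrr add0r.
  rewrite (cstE (K t)) (cstE (K t + alpha * h k)); apply/andP; split; apply: le_Rintegral => //; try exact: iK;
    try exact: i_cst; move=> s /=; rewrite in_itv/= => /andP[ts sth];
    have /andP[K1 K2] := chaser_bounds alpha_ge0 c_bv t0 ts => //.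
  by apply: (le_trans K2); rewrite lerD2l ler_wpM2l// lerBlDl ltW.
have I2 : 0 <= (\int[lebesgue_measure]_(s in `[0%R, h k[) K s)%R
    <= alpha * h k * h k.
  apply/andP; split.
    by apply: Rintegral_ge0 => s /=; rewrite in_itv/= => /andP[/chaser_ge0].
  have -> : alpha * h k * h k =
      (\int[lebesgue_measure]_(s in `[0%R, h k[) (alpha * h k))%R.
    by rewrite Rintegral_itvco_cst// subr0.
  apply: le_Rintegral => //; first exact: iK.
  move=> s /=; rewrite in_itv/= => /andP[s0 sh].
  by rewrite (le_trans (chaser_le s0))// ler_wpM2l// ltW.
exact: average_near (h_gt0 k) I1 I2.
Qed.

Let near_h (r : R) : 0 < r -> \forall k \near \oo, h k < r.
Proof.
move=> r0; have /cvgrPdist_lt/(_ _ r0) := h_cvg0.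
by apply: filterS => k; rewrite sub0r normrN => /(le_lt_trans (ler_norm _)).
Qed.

Let G_le (s : R) : `|G (y s)| <= M.
Proof.
rewrite /M; case: (G_cases (y s)) => -[_ ->].
- by rewrite gtr0_norm// lerDl.
- by rewrite normr0 addr_ge0.
- by rewrite lerDr.
Qed.

Let iG (t : R) : lebesgue_measure.-integrable `[0, t[ (EFin \o (G \o y)).
Proof.
apply: (@bounded_integrable _ _ _ _ _ _ M) => //.
- exact: itvco_lty.
- by have mGy := measurableT_comp mG my; exact: measurable_funS mGy.
- by move=> s _; exact: G_le.
Qed.

Let iq k (t : R) : lebesgue_measure.-integrable `[0, t[ (EFin \o q k).
Proof.
apply: (@bounded_integrable _ _ _ _ _ _ alpha) => //.
- exact: itvco_lty.
- exact: measurable_funS (mq k).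
- move=> s /=; rewrite in_itv/= => /andP[s0 _].
  by have /andP[q0 qa] := q_bounds k s0; rewrite ger0_norm.
Qed.

Let int_e_le k (t : R) : (\int[lebesgue_measure]_(s in `[0%R, t[) (e k s)%:E <=
  \int[lebesgue_measure]_(s in `[0%R, (Num.truncn t).+1%:R[) (e k s)%:E)%E.
Proof.
apply: ge0_subset_integral => //=.
- by apply/measurable_EFinP; apply: measurable_funS (me_ k).
- move=> s _; exact: normr_ge0.
- move=> s /=; rewrite !in_itv/= => /andP[s0 st].
  by rewrite s0 (lt_trans st)// truncnS_gt.
Qed.

(** The integrals of the slopes [q k] tend to [K t] by [slope_integral] and to the integral of
    [G (y s)] by [slope_L1_cvg]. *)
Lemma chaser_integral (t : R) : 0 <= t ->
  K t = (\int[lebesgue_measure]_(s in `[0%R, t[) G (y s))%R.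
Proof.
move=> t0; apply/eqP; rewrite -subr_eq0 -normr_le0; apply/ler_addgt0Pr => r r0.
rewrite add0r; have r20 : 0 < r / 2 by rewrite divr_gt0.
have ra : 0 < r / 2 / alpha by rewrite divr_gt0.
have [k [ek hk]] : exists k, (\int[lebesgue_measure]_(s in `[0%R, (Num.truncn t).+1%:R[)
    (e k s)%:E <= (r / 2)%:E)%E /\ h k < r / 2 / alpha.
  have [N _ HN] := filterI (slope_L1_cvg (Num.truncn t).+1 r20) (near_h ra).
  by exists N; apply: HN => /=.
have := slope_integral k t0.
have : alpha * h k <= r / 2 by rewrite mulrC -ler_pdivlMr// ltW.
have : `|(\int[lebesgue_measure]_(s in `[0%R, t[) q k s)%R -
    (\int[lebesgue_measure]_(s in `[0%R, t[) G (y s))%R| <= r / 2.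
  rewrite -RintegralB//.
  have iqG : lebesgue_measure.-integrable `[0, t[ (EFin \o (fun s => q k s - G (y s))).
    by apply: integrableB_EFin.
  apply: (le_trans (le_normr_Rintegral _ iqG)) => //.
  rewrite -lee_fin /Rintegral fineK; last first.
    by apply: integrable_fin_num => //; exact: integrable_norm.
  exact: le_trans (int_e_le k t) ek.
exact: distr_le_half.
Qed.

(* On the contact set the slopes lie in [[0, alpha]], away from [delta], and yet
   converge to [delta] in mean. *)
Lemma chaser_contact_null (t : R) : ~~ (0 <= delta <= alpha) ->
  lebesgue_measure (`[0, t[ `&` [set s | y s = 0]) = 0%E.
Proof.
move=> hdelta.
have [g g0 gP] : exists2 g, 0 < g & forall r, 0 <= r <= alpha -> g <= `|r - delta|.
  have [d0|d0] := ltP delta 0.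
    exists (- delta); first by rewrite oppr_gt0.
    by move=> r /andP[r0 _]; rewrite ger0_norm; lra.
  have da : alpha < delta by rewrite ltNge; apply: contra hdelta => ->; rewrite d0.
  exists (delta - alpha); first by rewrite subr_gt0.
  by move=> r /andP[_ ra]; rewrite ler0_norm; lra.
set N := _ `&` _.
have mN : measurable N.
  rewrite /N (_ : `[0, t[%classic = `[0, t[%classic `&` `[0, +oo[%classic); last first.
    by apply/esym/setIidPl.
  rewrite -setIA; apply: measurableI => //.
  exact: (my (measurable_itv _) (measurable_set1 0)).
apply/eqP; rewrite eq_le measure_ge0 andbT.
(* Chebyshev's inequality: [g] times the measure of [N] is at most the integral of the error, which
   can be made smaller than any [r]. *)
rewrite -(@lee_pmul2l _ g%:E) ?mule0// ?lte_fin//.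
apply/lee_addgt0Pr => r r0; rewrite add0e.
have [k _ /(_ k (leqnn k)) ek] := slope_L1_cvg (Num.truncn t).+1 r0.
apply: le_trans ek; apply: le_trans (int_e_le k t).
rewrite -[X in (X <= _)%E]integral_cst//.
have mek : measurable_fun (`[0, t[%classic : set R) (EFin \o e k).
  by apply/measurable_EFinP; apply: measurable_funS (me_ k).
apply: (@le_trans _ _ (\int[lebesgue_measure]_(s in N) (e k s)%:E)%E).
  apply: ge0_le_integral => //.
  - by move=> s _; rewrite lee_fin ltW.
  - by apply: measurable_funS mek => // s [].
  - move=> s [/=]; rewrite in_itv/= => /andP[s0 _] ys; rewrite lee_fin /e.
    case: (G_cases (y s)) => -[ys' ->]; rewrite ?ys ?ltxx// in ys' *.
    exact/gP/q_bounds.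
by apply: ge0_subset_integral => // [s _|s []//]; rewrite lee_fin normr_ge0.
Qed.

(** The refraction rate agrees with [G] except at contact times when [delta] is outside
    [[0, alpha]], and then these times form a null set. *)
Lemma chaser_equation (b t : R) : 0 <= t ->
  lebesgue_measure.-integrable `[0, t]
    (EFin \o (fun s => refraction_rate alpha delta b (c s + b - K s))) /\
  K t = (\int[lebesgue_measure]_(s in `[0%R, t])
    refraction_rate alpha delta b (c s + b - K s))%R.
Proof.
move=> t0; pose rate (v : R) := refraction_rate alpha delta b (v + b).
have -> : (fun s => refraction_rate alpha delta b (c s + b - K s)) = rate \o y.
  by apply/funext => s; rewrite /rate/= /y addrAC.
have rateE (v : R) : v != 0 \/ 0 <= delta <= alpha -> rate v = G v.
  have E1 : \1_(`]b, +oo[%classic) (v + b) = \1_(`]0%R, +oo[%classic) v :> R.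
    by rewrite !indicE !mem_setE !in_itv/= !andbT ltrDr.
  have E2 : \1_([set b]) (v + b) = \1_([set 0]) v :> R.
    suff E3 : (v + b \in [set b]) = (v \in [set 0]) by rewrite !indicE E3.
    by apply/idP/idP => /set_mem/= vb; apply/mem_set => /=; lra.
  rewrite /rate /refraction_rate E1 E2 => -[v0|->//].
  case: ifP => // _; rewrite /G [\1_([set 0]) v]indicE memNset ?mulr0 ?addr0//.
  exact/eqP.
have mrate : measurable_fun setT rate.
  rewrite /rate /refraction_rate; case: (0 <= delta <= alpha).
    apply: measurable_funD; apply: measurable_funM => //;
    apply: (measurableT_comp (@measurable_indic _ _ _ setT _ _)) => //;
    exact: measurable_funD.
  apply: measurable_funM => //.
  apply: (measurableT_comp (@measurable_indic _ _ _ setT _ _)) => //.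
  exact: measurable_funD.
have mry := measurableT_comp mrate my.
have rate_le (v : R) : `|rate v| <= M.
  have [v0|hd] := boolP ((v != 0) || (0 <= delta <= alpha)).
    have /rateE -> : v != 0 \/ 0 <= delta <= alpha by exact/orP.
    rewrite /M; case: (G_cases v) => -[_ ->].
    - by rewrite gtr0_norm// lerDl.
    - by rewrite normr0 addr_ge0.
    - by rewrite lerDr.
  move: hd; rewrite negb_or negbK => /andP[/eqP -> /negbTE hd].
  rewrite /rate /refraction_rate hd add0r indicE memNset ?mulr0 ?normr0 ?(ltW M_gt0)//=.
  by rewrite in_itv/= ltxx.
have ir : lebesgue_measure.-integrable `[0, t] (EFin \o (rate \o y)).
  apply: (@bounded_integrable _ _ _ _ _ _ M) => //.
  - exact: itvcc_lty.
  - apply: measurable_funS mry => // s /=.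
    by rewrite !in_itv/= andbT => /andP[].
  - by move=> s _; exact: rate_le.
split => //.
have ir' : lebesgue_measure.-integrable `[0, t[ (EFin \o (rate \o y)).
  by apply: integrableS ir => //; apply: subset_itvl; rewrite bnd_simp.
rewrite -Rintegral_itv_bndo_bndc// chaser_integral// /Rintegral; congr fine.
have [hd|hd] := boolP (0 <= delta <= alpha).
  by apply: eq_integral => s _; rewrite /= rateE//; right.
apply: ae_eq_integral => //.
- by have /integrableP[] := iG t.
- by have /integrableP[] := ir'.
exists (`[0, t[ `&` [set s | y s = 0]); split.
- rewrite (_ : `[0, t[%classic = `[0, t[%classic `&` `[0, +oo[%classic); last first.
    by apply/esym/setIidPl.
  rewrite -setIA; apply: measurableI => //.
  exact: (my (measurable_itv _) (measurable_set1 0)).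
- exact: chaser_contact_null.
- move=> s /=; apply: contra_notP => ns st; rewrite rateE//.
  by left; apply/eqP => ys; apply: ns.
Qed.

End path_representation.

(** * Small-time behaviour of the increments *)

(** Used with [u] and [v] the real and imaginary parts of the integral in the Lévy exponent, scaled
    by time. *)
Lemma damped_cos_cvg0 {R : realType} (u v : nat -> R) :
  u n @[n --> \oo] --> 0 -> v n @[n --> \oo] --> 0 ->
  1 - expR (- u n) * cos (v n) @[n --> \oo] --> 0.
Proof.
move=> u0 v0.
have -> : 0 = 1 - expR (- 0) * cos 0 :> R by rewrite oppr0 expR0 cos0 mulr1 subrr.
apply: cvgB; first exact: cvg_cst.
apply: cvgM; last exact: (cvg_comp _ _ v0 (@continuous_cos R _)).
exact: (cvg_comp _ _ (cvgN u0) (@continuous_expR R _)).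
Qed.

Lemma integrableMr_cst {R : realType} d (T : measurableType d)
    (mu : {measure set T -> \bar R}) (f : T -> R) (r : R) :
  mu.-integrable setT (EFin \o f) -> mu.-integrable setT (EFin \o (fun x => f x * r)).
Proof.
move=> fi; have := integrableZr measurableT r fi.
by apply: eq_integrable.
Qed.

Section small_time_increments.
Context {R : realType}.
Implicit Types x l : R.

Lemma sin_le_norm x : `|sin x| <= `|x|.
Proof.
wlog x0 : x / 0 <= x.
  move=> H; have [x0|x0] := leP 0 x; first exact: H.
  by rewrite -(normrN x) -(normrN (sin x)) -sinN H// oppr_ge0 ltW.
move: x0; rewrite le_eqVlt => /predU1P[<-|x0]; first by rewrite sin0.
have dsin (v : R) : v \in `]0, x[ -> is_derive v 1 sin (cos v).
  by move=> _; exact: is_derive_sin.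
have csin : {within `[0, x], continuous (@sin R)}.
  by apply: continuous_subspaceT => v; exact: continuous_sin.
have [u _] := MVT x0 dsin csin.
by rewrite sin0 !subr0 => ->; rewrite normrM ler_piMl// cos_max.
Qed.

Lemma one_sub_cos_le_norm x : 1 - cos x <= `|x|.
Proof.
have -> : 1 - cos x = 2 * sin (x / 2) ^+ 2.
  have -> : cos x = cos (x / 2 + x / 2) by rewrite -splitr.
  by rewrite cosD -!expr2 (cos2sin2 (x / 2)); ring.
have := sin_le_norm (x / 2); rewrite normrM [`|2^-1|]ger0_norm ?invr_ge0// => H.
have s1 : `|sin (x / 2)| <= 1 by exact: sin_max.
have s0 := normr_ge0 (sin (x / 2)).
rewrite -(real_normK (num_real (sin (x / 2)))) expr2.
have : `|sin (x / 2)| * `|sin (x / 2)| <= 1 * `|sin (x / 2)| by rewrite ler_wpM2r.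
lra.
Qed.

Lemma cexp_imag (v : R) : cexp (Complex 0 v) = Complex (cos v) (sin v).
Proof. by rewrite /cexp/= expR0 mul1r. Qed.

Variable Pi : {measure set (measurableTypeR R) -> \bar R}.
Hypothesis Pi_levy : levy_measure Pi.
Hypothesis Pi_bv : forall l : R, cintegrable Pi [set~ 0%R]
  (fun y : R => 1 - cexp (Complex 0 (l * y))).

Let mD : measurable ([set~ 0%R] : set (measurableTypeR R)).
Proof. exact: measurableC. Qed.

(** A Lévy measure only makes [min(1, y ^+ 2)] integrable, which suffices for large [y]; for small
    [y] the integrability of [sin y], from the imaginary part of the drift integrand, yields that of
    [y]. *)
Let integrable_min1 : Pi.-integrable [set~ 0] (fun y : R => (Order.min 1 `|y|)%:E).
Proof.
have [_ isin] := Pi_bv 1.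
have [_ ilevy] := Pi_levy.
have mmin2 : measurable_fun ([set~ 0%R] : set (measurableTypeR R)) (fun y : R => Order.min 1 (y ^+ 2)).
  by apply: measurable_minr => //; apply: measurable_funX.
have imin2 : Pi.-integrable [set~ 0] (EFin \o (fun y : R => Order.min 1 (y ^+ 2))).
  apply/integrableP; split; first exact/measurable_EFinP.
  under eq_integral => y _.
    rewrite /= ger0_norm; last by rewrite le_min ler01 sqr_ge0.
    over.
  exact: ilevy.
have isin' : Pi.-integrable [set~ 0] (EFin \o (fun y : R => (cos 1)^-1 * `|sin y|)).
  rewrite (_ : _ \o _ = (fun y => (cos 1)^-1%:E * (`|sin y|)%:E)%E); last first.
    by apply/funext => y; rewrite /= EFinM.
  apply: integrableZl => //.
  move: (integrable_norm isin); congr (integrable _ _ _); apply/funext => y.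
  by rewrite /comp cexp_imag /= mul1r sub0r normrN.
have := integrableD mD isin' imin2; apply: le_integrable => //.
  by apply/measurable_EFinP; apply: measurable_minr => //; exact: measurableT_comp.
move=> y _ /=; rewrite lee_fin.
have m0 : 0 <= Order.min 1 `|y| by rewrite le_min ler01 normr_ge0.
have m20 : 0 <= Order.min 1 (y ^+ 2) by rewrite le_min ler01 sqr_ge0.
have cs0 : 0 <= (cos 1)^-1 * `|sin y| :> R.
  by rewrite mulr_ge0// invr_ge0 ltW// cos1_gt0.
rewrite (ger0_norm m0) (ger0_norm (addr_ge0 cs0 m20)).
have [y1|y1] := leP 1 `|y|.
  have y2 : 1 <= y ^+ 2.
    by rewrite -(real_normK (num_real (y : R))) exprn_ege1.
  by rewrite (min_idPl y2) lerDr.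
rewrite -[leLHS]addr0 lerD// mulrC ler_pdivlMr ?cos1_gt0// mulrC.
exact: sin_lower_bound (ltW y1).
Qed.

Let h (n : nat) : R := n.+1%:R^-1.

Let h_gt0 n : 0 < h n. Proof. by rewrite invr_gt0. Qed.

Let h_le1 n : h n <= 1. Proof. by rewrite invf_le1// ler1n. Qed.

Let h_cvg0 : h n @[n --> \oo] --> 0.
Proof. exact: cvg_harmonic. Qed.

(* The two bounds [|g x| <= 2] and [|g x| <= |x|] make
   [(2 + |l|) min(1, |y|)] a dominating function. *)
Let scaled_integral_cvg0 (g : R -> R) l : measurable_fun setT g ->
  (forall x, `|g x| <= 2) -> (forall x, `|g x| <= `|x|) ->
  h n * (\int[Pi]_(y in [set~ 0%R]) g (l / h n * y))%R @[n --> \oo] --> 0.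
Proof.
move=> mg g2 g1.
have bound n (y : R) : `|h n * g (l / h n * y)| <= (2 + `|l|) * Order.min 1 `|y|.
  rewrite normrM (gtr0_norm (h_gt0 n)).
  have H1 : h n * `|g (l / h n * y)| <= 2.
    by rewrite -[leRHS]mul1r ler_pM// ltW.
  have H2 : h n * `|g (l / h n * y)| <= `|l| * `|y|.
    apply: le_trans (ler_wpM2l (ltW (h_gt0 n)) (g1 _)) _.
    rewrite !normrM normfV (gtr0_norm (h_gt0 n)).
    by rewrite mulrA mulrCA mulfV ?mulr1// gt_eqF.
  have l0 := normr_ge0 l; have y0 := normr_ge0 y.
  case: (leP 1 `|y|) => y1; first by rewrite mulr1; lra.
  apply: le_trans H2 _; rewrite ler_wpM2r//; lra.
have mgn n : measurable_fun ([set~ 0%R] : set (measurableTypeR R)) (fun y => g (l / h n * y)).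
  by apply: (measurableT_comp mg); exact: measurable_funM.
have igmin : Pi.-integrable [set~ 0] (fun y : R => (2 + `|l|)%:E * (Order.min 1 `|y|)%:E)%E.
  exact: integrableZl.
have mhgn n : measurable_fun ([set~ 0%R] : set (measurableTypeR R)) (fun y => (h n * g (l / h n * y))%:E).
  by apply/measurable_EFinP; exact: measurable_funM.
have cvg_pt (y : R) : (h n * g (l / h n * y))%:E @[n --> \oo] --> 0%:E.
  apply: cvg_EFin; first exact: nearW.
  apply/cvgrPdist_le => e e0.
  have /cvgrPdist_lt/(_ _ (divr_gt0 e0 (ltr0n R 2))) := h_cvg0.
  apply: filterS => n; rewrite !sub0r !normrN (gtr0_norm (h_gt0 n)) => hn.
  rewrite normrM (gtr0_norm (h_gt0 n)).
  apply: (le_trans (ler_wpM2l (ltW (h_gt0 n)) (g2 _))).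
  by rewrite -ler_pdivlMr// ltW.
have [] := @dominated_convergence _ _ _ Pi [set~ 0] mD
  (fun n y => (h n * g (l / h n * y))%:E) (cst 0%E)
  (fun y : R => (2 + `|l|)%:E * (Order.min 1 `|y|)%:E)%E.
- exact: mhgn.
- exact: measurable_cst.
- by apply/aeW => y _; exact: cvg_pt.
- exact: igmin.
- by apply/aeW => y n _; exact: bound n y.
move=> _ _ cv.
move: cv; rewrite integral0 => /fine_cvgP[_]; apply: cvg_trans.
apply: near_eq_cvg; apply: nearW => n /=.
rewrite -RintegralZl//.
have : Pi.-integrable [set~ 0] (fun y => (h n)^-1%:E * (h n * g (l / h n * y))%:E)%E.
  apply: integrableZl => //; apply: le_integrable igmin => // y _.
  rewrite -EFinM /= lee_fin; apply: le_trans (bound n y) _; exact: ler_norm.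
apply: eq_integrable => // y _ /=.
by rewrite -EFinM mulKf// gt_eqF.
Qed.

Let one_sub_cos_bounds x : `|1 - cos x| <= 2 /\ `|1 - cos x| <= `|x|.
Proof.
rewrite ger0_norm ?one_sub_cos_ge0//; split.
  exact: one_sub_cos_le2.
exact: one_sub_cos_le_norm.
Qed.

Let cvg_cos_part l :
  h n * (\int[Pi]_(y in [set~ 0%R]) (1 - cos (l / h n * y)))%R @[n --> \oo] --> 0.
Proof.
apply: (@scaled_integral_cvg0 (fun v => 1 - cos v)).
- by apply: measurable_funB => //; apply: continuous_measurable_fun => v; exact: continuous_cos.
- by move=> v; have [] := one_sub_cos_bounds v.
- by move=> v; have [] := one_sub_cos_bounds v.
Qed.

Let cvg_sin_part l :
  h n * (\int[Pi]_(y in [set~ 0%R]) (- sin (l / h n * y)))%R @[n --> \oo] --> 0.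
Proof.
apply: (@scaled_integral_cvg0 (fun v => - sin v)).
- by apply: measurableT_comp => //; apply: continuous_measurable_fun => v; exact: continuous_sin.
- by move=> v; rewrite normrN (le_trans (sin_max v))// ler1n.
- by move=> v; rewrite normrN; exact: sin_le_norm.
Qed.

Variables (d : measure_display) (T : measurableType d) (P : probability T R).
Variables (X : R -> {RV P >-> R}) (delta : R).
Hypothesis X_drift : is_drift X Pi delta.

Let mX t : measurable_fun setT (X t : T -> R). Proof. exact: measurable_funPT. Qed.

Let iP (f : R -> R) (t v M : R) : measurable_fun setT f -> (forall u, `|f u| <= M) ->
  P.-integrable setT (EFin \o (fun w => f (v * (X t w - X 0 w)))).
Proof.
move=> mf fM; apply: (@bounded_integrable _ _ _ _ _ _ M) => //.
- exact: le_lt_trans (probability_le1 P measurableT) (ltry 1).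
- apply: (measurableT_comp mf); apply: measurable_funM => //.
  exact: measurable_funB.
Qed.

Lemma char_funE t l : char_fun X t l =
  Complex (\int[P]_w cos (l * (X t w - X 0 w)))%R
          (\int[P]_w sin (l * (X t w - X 0 w)))%R.
Proof.
rewrite /char_fun /cintegral; congr Complex; apply: eq_Rintegral => w _.
  by rewrite cexp_imag.
by rewrite cexp_imag.
Qed.

(** The cosine of the scaled slope combines the real and imaginary parts of the characteristic
    function at time [h n] and frequency [l / h n]; the phase [delta * l] due to the drift
    cancels. *)
Lemma expected_slope_deviation l n :
  (\int[P]_w (1 - cos (l * ((X (h n) w - X 0 w) / h n - delta))))%R =
  1 - expR (- (h n * (\int[Pi]_(y in [set~ 0%R]) (1 - cos (l / h n * y)))%R)) *
      cos (h n * (\int[Pi]_(y in [set~ 0%R]) (- sin (l / h n * y)))%R).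
Proof.
have [_ /(_ (h n) (l / h n) (ltW (h_gt0 n)))] := X_drift.
rewrite char_funE /cintegral.
have -> : (\int[Pi]_(y in [set~ 0%R]) complex.Re (1 - cexp (Complex 0 (l / h n * y))))%R
    = (\int[Pi]_(y in [set~ 0%R]) (1 - cos (l / h n * y)))%R.
  by apply: eq_Rintegral => y _; rewrite cexp_imag.
have -> : (\int[Pi]_(y in [set~ 0%R]) complex.Im (1 - cexp (Complex 0 (l / h n * y))))%R
    = (\int[Pi]_(y in [set~ 0%R]) (- sin (l / h n * y)))%R.
  by apply: eq_Rintegral => y _; rewrite cexp_imag/= sub0r.
set A := (\int[Pi]_(y in _) (1 - _))%R; set B := (\int[Pi]_(y in _) (- _))%R.
set C := (\int[P]_w cos _)%R; set S := (\int[P]_w sin _)%R.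
rewrite /cexp /= => -[CE SE].
have hn0 : h n != 0 by rewrite gt_eqF.
have reE : - h n * (- 0 + A) - - 0 * (- (delta * (l / h n)) + B) = - (h n * A).
  by ring.
have imE : - h n * (- (delta * (l / h n)) + B) + - 0 * (- 0 + A) =
    delta * l - h n * B by field.
rewrite reE imE mul0r subr0 in CE; rewrite reE imE mul0r addr0 in SE.
have cosE (w : T) : 1 - cos (l * ((X (h n) w - X 0 w) / h n - delta)) =
    1 - (cos (l / h n * (X (h n) w - X 0 w)) * cos (delta * l)
         + sin (l / h n * (X (h n) w - X 0 w)) * sin (delta * l)).
  rewrite -cosB; congr (1 - cos _); field; exact: hn0.
under eq_Rintegral do rewrite cosE.
have icos : P.-integrable setT (EFin \o (fun w => cos (l / h n * (X (h n) w - X 0 w)))).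
  apply: (@iP _ _ _ 1); last exact: cos_max.
  by apply: continuous_measurable_fun => v; exact: continuous_cos.
have isin : P.-integrable setT (EFin \o (fun w => sin (l / h n * (X (h n) w - X 0 w)))).
  apply: (@iP _ _ _ 1); last exact: sin_max.
  by apply: continuous_measurable_fun => v; exact: continuous_sin.
have icos' := integrableMr_cst (cos (delta * l)) icos.
have isin' := integrableMr_cst (sin (delta * l)) isin.
rewrite RintegralB//; last 2 first.
- apply: (@bounded_integrable _ _ _ _ _ _ 1) => //.
    exact: le_lt_trans (probability_le1 P measurableT) (ltry 1).
  by move=> w _; rewrite normr1.
- exact: (integrableD measurableT icos' isin').
rewrite RintegralD// !RintegralZr//.
rewrite -/C -/S CE SE Rintegral_cst//= probability_setT mulr1.
have -> : cos (h n * B) = cos (delta * l - h n * B) * cos (delta * l)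
    + sin (delta * l - h n * B) * sin (delta * l).
  by rewrite -cosB -cosN; congr cos; ring.
by ring.
Qed.

Lemma expected_slope_cvg0 l :
  (\int[P]_w (1 - cos (l * ((X (h n) w - X 0 w) / h n - delta))))%R @[n --> \oo] --> 0.
Proof.
under eq_fun do rewrite expected_slope_deviation.
exact: damped_cos_cvg0 (@cvg_cos_part l) (@cvg_sin_part l).
Qed.

End small_time_increments.

(** The series of the [F k] has integral at most [r], so it is finite almost everywhere and its
    tails, which dominate its terms, vanish. *)
Lemma ae_cvg0_of_summable {R : realType} d (T : measurableType d)
    (mu : {measure set T -> \bar R}) (F : nat -> T -> \bar R) (r : R) :
  0 <= r -> (forall k, measurable_fun setT (F k)) -> (forall k w, (0 <= F k w)%E) ->
  (forall k, (\int[mu]_w F k w <= (r / (2 ^ k.+1)%:R)%:E)%E) ->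
  {ae mu, forall w, F k w @[k --> \oo] --> 0%E}.
Proof.
move=> r0 mF F0 intF.
pose G w := (\sum_(k <oo) F k w)%E.
have G0 w : (0 <= G w)%E by apply: nneseries_ge0 => k _ _.
have mG : measurable_fun setT G.
  by apply: ge0_emeasurable_sum => // k w _ _.
have intG : (\int[mu]_w G w <= r%:E)%E.
  rewrite integral_nneseries//.
  apply: le_trans (epsilon_trick0 xpredT r0).
  by apply: lee_nneseries => k _; [move=> _; exact: integral_ge0|exact: intF].
have iG : mu.-integrable setT G.
  apply/integrableP; split => //.
  under eq_integral do rewrite gee0_abs//.
  exact: le_lt_trans intG (ltry _).
apply: filterS (integrable_ae measurableT iG) => w /(_ I) Gfin.
have tail := @nneseries_tail_cvg _ (F^~ w) xpredT.
have {}tail : (\sum_(N <= k <oo) F k w)%E @[N --> \oo] --> 0%E.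
  by apply: tail => // ; rewrite ltey_eq Gfin.
apply: (@squeeze_cvge _ _ _ _ (cst 0%E) _ (fun N => (\sum_(N <= k <oo) F k w)%E)) => //.
  apply: nearW => k; rewrite F0/=.
  have := @nneseries_lim_ge _ (F^~ w) xpredT k k.+1 (fun n _ _ => F0 n w).
  by rewrite big_nat1.
exact: cvg_cst.
Qed.

(** * From expectations to almost every path *)

Section almost_sure_slope.
Context {R : realType} {d : measure_display} {T : measurableType d}.
Variables (P : probability T R) (X : R -> {RV P >-> R}).
Hypothesis X_stat : stationary_increments X.

Let mX t : measurable_fun setT (X t : T -> R). Proof. exact: measurable_funPT. Qed.

Let mXB s t : measurable_fun setT (fun w => X t w - X s w).
Proof. exact: measurable_funB. Qed.

Lemma integral_increment (g : R -> \bar R) (s t : R) : 0 <= s -> 0 <= t ->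
  measurable_fun setT g -> (forall v, (0 <= g v)%E) ->
  (\int[P]_w g (X (s + t) w - X s w)%R = \int[P]_w g (X t w - X 0 w)%R)%E.
Proof.
move=> s0 t0 mg g0.
have -> : (\int[P]_w g (X (s + t) w - X s w)%R =
    \int[pushforward P (fun w => X (s + t) w - X s w)%R]_v g v)%E.
  by rewrite ge0_integral_pushforward.
have -> : (\int[P]_w g (X t w - X 0 w)%R =
    \int[pushforward P (fun w => X t w - X 0 w)%R]_v g v)%E.
  by rewrite ge0_integral_pushforward.
by apply: eq_measure_integral => B mB _; exact: X_stat.
Qed.

Variables (g : nat -> R -> R) (h : nat -> R) (N : nat).
Hypotheses (h_ge0 : forall k, 0 <= h k) (g_cont : forall k, continuous (g k)).
Hypothesis g_bounds : forall k v, 0 <= g k v <= 2.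
Hypothesis g_small : forall k,
  (\int[P]_w (g k (X (h k) w - X 0 w))%:E <= ((2 ^ k.+1)%:R^-1)%:E)%E.

Let S n k w : R := (2 ^+ n)^-1 *
  \sum_(i < N * 2 ^ n) g k (X (i.+1%:R / 2 ^+ n + h k) w - X (i.+1%:R / 2 ^+ n) w).

Let g_ge0 k v : 0 <= g k v. Proof. by have /andP[] := g_bounds k v. Qed.

Let S_ge0 n k w : 0 <= S n k w.
Proof.
by apply: mulr_ge0; [rewrite invr_ge0 ltW// exp2_gt0|apply: sumr_ge0].
Qed.

Let mg k : measurable_fun setT (g k).
Proof. exact: continuous_measurable_fun. Qed.

Let mgX k s t : measurable_fun setT (fun w => g k (X t w - X s w)).
Proof. exact: (measurableT_comp (@mg k) (@mXB s t)). Qed.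

Let mS n k : measurable_fun setT (S n k).
Proof.
apply: measurable_funM => //; apply: measurable_sum => i; exact: mgX.
Qed.

(** By stationarity all terms of the sum have the same mean, so the bound does not depend on the
    mesh. *)
Let int_S n k : (\int[P]_w (S n k w)%:E <= (N%:R / (2 ^ k.+1)%:R)%:E)%E.
Proof.
rewrite /S; under eq_integral do rewrite EFinM.
have e0 : 0 <= (2 ^+ n)^-1 :> R by rewrite invr_ge0 ltW// exp2_gt0.
rewrite ge0_integralZl//; last 2 first.
- by apply/measurable_EFinP; apply: measurable_sum => i; exact: mgX.
- by move=> w _; rewrite lee_fin sumr_ge0.
under eq_integral do rewrite -sumEFin.
rewrite ge0_integral_sum//; last 2 first.
- by move=> i; apply/measurable_EFinP; exact: mgX.
- by move=> i w _; rewrite lee_fin.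
have inc i : (\int[P]_w (g k (X (i.+1%:R / 2 ^+ n + h k) w - X (i.+1%:R / 2 ^+ n) w))%:E =
    \int[P]_w (g k (X (h k) w - X 0 w))%:E)%E.
  apply: (@integral_increment (EFin \o g k)) => //.
  - exact/measurable_EFinP.
  - by move=> v; rewrite lee_fin.
apply: (@le_trans _ _ ((2 ^+ n)^-1%:E * \sum_(i < N * 2 ^ n) ((2 ^ k.+1)%:R^-1)%:E)%E).
  by apply: lee_wpmul2l; [rewrite lee_fin|apply: lee_sum => i _; rewrite inc; exact: g_small].
rewrite sumEFin sumr_const card_ord -EFinM lee_fin -[X in _ * X]mulr_natl natrM natrX.
by rewrite [leLHS]mulrA [_^-1 * _]mulrC mulfK// gt_eqF ?exp2_gt0.
Qed.

(* Writing the time integral as a limit of Riemann sums avoids any joint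
   measurability of [X] in time and chance. *)
Lemma ae_riemann_integral_cvg0 :
  {ae P, forall w, right_cont (fun t => X t w)} ->
  {ae P, forall w, (\int[lebesgue_measure]_(s in `[0%R, N%:R[)
     (g k (X (s + h k) w - X s w))%:E)%E @[k --> \oo] --> 0%E}.
Proof.
(* The lower limit is measurable in [w] and obeys Fatou's lemma; on right-continuous paths it equals
   the time integral. *)
pose F k w : \bar R := limn_einf (fun n => (S n k w)%:E).
have mF k : measurable_fun setT (F k).
  rewrite /F /limn_einf; apply: measurableT_comp => //.
  apply: measurable_fun_limn_esup => n; apply: measurableT_comp => //.
  exact/measurable_EFinP.
have F0 k w : (0 <= F k w)%E.
  rewrite /F limn_einf_lim; apply: lime_ge; first exact: is_cvg_einfs.
  by apply: nearW => n; apply: le_ereal_inf_tmp => _ [m _ <-]; rewrite lee_fin.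
have intF k : (\int[P]_w F k w <= (N%:R / (2 ^ k.+1)%:R)%:E)%E.
  apply: le_trans (fatou P measurableT _ _) _ => //.
  - by move=> n; exact/measurable_EFinP.
  - by move=> n w _; rewrite lee_fin.
  rewrite limn_einf_lim; apply: lime_le; first exact: is_cvg_einfs.
  apply: nearW => n; apply: le_trans (int_S n k).
  by apply: ereal_inf_lbound; exists n => /=.
move=> rcX.
have := ae_cvg0_of_summable (ler0n R N) mF F0 intF.
apply: filterS2 rcX => w rc; apply: cvg_trans.
apply: near_eq_cvg; apply: nearW => k; apply/esym.
have rcg : right_cont (fun s => g k (X (s + h k) w - X s w)).
  have rcd := right_contB (right_cont_shift (h_ge0 k) rc) rc.
  exact: (right_cont_comp (@g_cont k) rcd).
have gb s : 0 <= g k (X (s + h k) w - X s w) <= 2 by exact: g_bounds.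
by have [E _] := cvg_limn_einf_sup (@riemann_sum_cvg _ _ _ N rcg gb).
Qed.

End almost_sure_slope.

Section levy_slope.
Context {R : realType} {d : measure_display} {T : measurableType d}.
Variables (P : probability T R) (X : R -> {RV P >-> R}).
Variables (Pi : {measure set (measurableTypeR R) -> \bar R}) (delta l : R).
Hypotheses (X_stat : stationary_increments X) (Pi_levy : levy_measure Pi).
Hypothesis X_drift : is_drift X Pi delta.
Hypothesis X_cadlag : {ae P, forall w, cadlag (fun t => X t w)}.

Lemma ae_slope_cvg : exists h : nat -> R,
  [/\ forall k, 0 < h k, h k @[k --> \oo] --> 0 &
  {ae P, forall w, forall N : nat,
    (\int[lebesgue_measure]_(s in `[0%R, N%:R[)
       (1 - cos (l * ((X (s + h k)%R w - X s w) / h k - delta)))%:E)%E @[k --> \oo] --> 0%E}].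
Proof.
have Pi_bv := X_drift.1.
have slope0 := expected_slope_cvg0 Pi_levy Pi_bv X_drift l.
pose psi n := (\int[P]_w (1 - cos (l * ((X (n.+1%:R^-1)%R w - X 0 w) / n.+1%:R^-1 - delta))))%R.
(* Expectations tending to 0 give almost sure convergence along a subsequence: the indices make them
   summable, and [k <= n] makes the step lengths tend to 0. *)
have pick (k : nat) : {n : nat | (k <= n)%N /\ psi n < (2 ^ k.+1)%:R^-1}.
  apply: cid.
  have e0 : 0 < (2 ^ k.+1)%:R^-1 :> R by rewrite invr_gt0 ltr0n expn_gt0.
  have /cvgrPdist_lt/(_ _ e0) [m _ Hm] := slope0.
  exists (maxn k m); split; first exact: leq_maxl.
  have := Hm (maxn k m) (leq_maxr _ _); rewrite sub0r normrN.
  exact: le_lt_trans (ler_norm _).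
pose h k : R := (sval (pick k)).+1%:R^-1.
have h_gt0 k : 0 < h k by rewrite invr_gt0.
have h_cvg0 : h k @[k --> \oo] --> 0.
  apply: (@squeeze_cvgr _ _ _ _ (cst 0) harmonic); last exact: cvg_harmonic.
    apply: nearW => k; rewrite ltW//= lef_pV2 ?posrE// ler_nat ltnS.
    by case: (svalP (pick k)).
  exact: cvg_cst.
exists h; split => //.
pose g k (v : R) := 1 - cos (l * (v / h k - delta)).
have g_cont k : continuous (g k).
  move=> v; apply: cvgB; first exact: cvg_cst.
  have lv : l * (u / h k - delta) @[u --> v] --> l * (v / h k - delta).
    apply: cvgM; first exact: cvg_cst.
    apply: cvgB; last exact: cvg_cst.
    by apply: cvgM => //; exact: cvg_cst.
  exact: (cvg_comp _ _ lv (@continuous_cos R _)).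
have g_bounds k v : 0 <= g k v <= 2 by rewrite one_sub_cos_ge0 one_sub_cos_le2.
have g_small k : (\int[P]_w (g k (X (h k) w - X 0 w))%:E <= ((2 ^ k.+1)%:R^-1)%:E)%E.
  have ig : P.-integrable setT (EFin \o (fun w => g k (X (h k) w - X 0 w))).
    apply: (@bounded_integrable _ _ _ _ _ _ 2) => //.
    - exact: le_lt_trans (probability_le1 P measurableT) (ltry 1).
    - apply: (measurableT_comp (continuous_measurable_fun (@g_cont k))).
      by apply: measurable_funB; exact: measurable_funPT.
    - by move=> w _; have /andP[? ?] := g_bounds k (X (h k) w - X 0 w); rewrite ger0_norm.
  have fing := integrable_fin_num measurableT ig.
  rewrite -(fineK fing) lee_fin; apply: ltW.
  by case: (svalP (pick k)).
apply: ae_foralln => N.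
have := @ae_riemann_integral_cvg0 _ _ _ P X X_stat g h N (fun k => ltW (h_gt0 k))
  g_cont g_bounds g_small.
by apply; apply: filterS X_cadlag => w [].
Qed.

End levy_slope.

(** * Pathwise uniqueness *)

Lemma itvoc_lty {R : realType} (a t : R) : (lebesgue_measure `]a, t]%classic < +oo)%E.
Proof. by rewrite lebesgue_measure_itv/=; case: ifP => _; rewrite ?ltry// -EFinB ltry. Qed.

Section pathwise_uniqueness.
Context {R : realType}.
Variables (g : R -> R) (M : R) (x y z : R -> R).
Hypothesis g_nondecreasing : {homo g : u v / u <= v}.
Hypothesis g_le : forall v, `|g v| <= M.

Let I (f : R -> R) (a t : R) : R := (\int[lebesgue_measure]_(s in `[a, t]) g (f s))%R.
Let itg (f : R -> R) (t : R) :=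
  lebesgue_measure.-integrable `[0, t] (EFin \o (fun s => g (f s))).

Hypothesis y_sol : forall t, 0 <= t -> itg y t /\ y t = x t - I y 0 t.
Hypothesis z_sol : forall t, 0 <= t -> itg z t /\ z t = x t - I z 0 t.

Let itg_sub f s t : 0 <= s -> itg f t ->
  lebesgue_measure.-integrable `]s, t] (EFin \o (fun s => g (f s))).
Proof.
move=> s0; apply: integrableS => // u /=; rewrite !in_itv/= => /andP[su ->].
by rewrite andbT (le_trans s0)// ltW.
Qed.

Let I_split f s t : 0 <= s -> s <= t -> itg f t ->
  I f 0 t = I f 0 s + (\int[lebesgue_measure]_(u in `]s, t]) g (f u))%R.
Proof.
move=> s0 st ft; rewrite /I.
have E : `[0, t]%classic = `[0, s]%classic `|` `]s, t]%classic :> set R.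
  by rewrite -itv_bndbnd_setU// bnd_simp.
rewrite {1}E Rintegral_setU//; first by rewrite -E.
by apply/disj_setPS => u [] /=; rewrite !in_itv/= => /andP[_ us] /andP[su _]; lra.
Qed.

Let D t := y t - z t.

Let D_diff s t : 0 <= s -> s <= t ->
  D t = D s - ((\int[lebesgue_measure]_(u in `]s, t]) g (y u))%R
               - (\int[lebesgue_measure]_(u in `]s, t]) g (z u))%R).
Proof.
move=> s0 st; have t0 := le_trans s0 st.
have [ity yt] := y_sol t0; have [itz zt] := z_sol t0.
have [_ ys] := y_sol s0; have [_ zs] := z_sol s0.
rewrite /D yt zt ys zs (I_split s0 st ity) (I_split s0 st itz).
by ring.
Qed.

Let I_bound f s t : 0 <= s -> s <= t -> itg f t ->
  `|(\int[lebesgue_measure]_(u in `]s, t]) g (f u))%R| <= M * (t - s).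
Proof.
move=> s0 st ft; have ift := itg_sub s0 ft.
apply: (le_trans (le_normr_Rintegral _ ift)) => //.
have -> : M * (t - s) = (\int[lebesgue_measure]_(u in `]s, t]) M)%R.
  rewrite Rintegral_cst//= lebesgue_measure_itv/= lte_fin.
  case: ltP => [_|ts]; first by rewrite -EFinB.
  by have -> : t = s by [apply/eqP; rewrite eq_le ts st]; rewrite subrr.
apply: le_Rintegral => //; first exact: integrable_norm.
apply: (@bounded_integrable _ _ _ _ _ (fun=> M) `|M|) => //.
exact: itvoc_lty.
Qed.

(** The solutions may jump, but [x] cancels in their difference. This continuity makes [D]
    nonpositive at the supremum taken in [solution_le]. *)
Let D_lip s t : 0 <= s -> s <= t -> `|D t - D s| <= 2 * M * (t - s).
Proof.
move=> s0 st; have t0 := le_trans s0 st.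
have [ity _] := y_sol t0; have [itz _] := z_sol t0.
have := I_bound s0 st ity; have := I_bound s0 st itz.
rewrite (D_diff s0 st); move: (Rintegral _ _ _) (Rintegral _ _ _) => v w.
by rewrite !ler_norml; lra.
Qed.

(* After the last time [s] before [t] at which [y <= z], the difference [y - z]
   can only decrease. *)
Lemma solution_le t : 0 <= t -> y t <= z t.
Proof.
move=> t0; rewrite leNgt; apply/negP => zy.
have Dt : 0 < D t by rewrite subr_gt0.
have M0 : 0 <= M by apply: le_trans (g_le 0).
have D0 : D 0 = 0.
  have [_ y0] := y_sol (lexx 0); have [_ z0] := z_sol (lexx 0).
  by rewrite /D y0 z0 /I set_itv1 !Rintegral_set1 subrr.
pose E := [set s | 0 <= s <= t /\ D s <= 0].
have E0 : E 0 by rewrite /E/= lexx t0 D0.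
have Esup : has_sup E by split; [exists 0|exists t => s [/andP[]]].
pose s := sup E.
have s0 : 0 <= s by apply: sup_upper_bound.
have st : s <= t by apply: ge_sup; [exists 0|move=> u [/andP[]]].
have Ds : D s <= 0.
  apply/ler_addgt0Pr => e e0; rewrite add0r.
  (* The Lipschitz constant [2 * M] may be 0, hence the added 1. *)
  have c0 : 0 < e / (2 * M + 1) by rewrite divr_gt0//; lra.
  have [u [/andP[u0 ut] Du] su] := sup_adherent c0 Esup.
  have us : u <= s by apply: sup_upper_bound => //; rewrite /E/= u0 ut.
  have := D_lip u0 us.
  have : 2 * M * (s - u) <= (2 * M + 1) * (e / (2 * M + 1)).
    by apply: ler_pM; rewrite ?mulr_ge0 ?subr_ge0//; rewrite -/s in su; lra.
  have -> : (2 * M + 1) * (e / (2 * M + 1)) = e.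
    by rewrite mulrC divfK// gt_eqF//; lra.
  by rewrite ler_norml; lra.
have after u : s < u -> u <= t -> z u <= y u.
  move=> su ut; rewrite leNgt; apply/negP => yz.
  have : u <= s.
    apply: sup_upper_bound => //; rewrite /E/= ut (le_trans s0 (ltW su)); split => //.
    by rewrite subr_le0 ltW.
  by rewrite leNgt su.
have [ity _] := y_sol t0; have [itz _] := z_sol t0.
have : (\int[lebesgue_measure]_(u in `]s, t]) g (z u))%R <=
    (\int[lebesgue_measure]_(u in `]s, t]) g (y u))%R.
  apply: le_Rintegral => //; [exact: itg_sub|exact: itg_sub|].
  move=> u /=; rewrite in_itv/= => /andP[su ut].
  by apply: g_nondecreasing; exact: after.
move: Dt; rewrite (D_diff s0 st).
move: (Rintegral _ _ _) (Rintegral _ _ _) => v w; lra.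
Qed.

End pathwise_uniqueness.

Section refraction.
Context {R : realType}.
Variables (alpha delta b : R).
Hypothesis alpha_gt0 : 0 < alpha.

Let indicI v : \1_(`]b, +oo[%classic) v = (b < v)%R%:R :> R.
Proof. by rewrite indicE mem_setE in_itv/= andbT. Qed.

Let indic1 v : \1_([set b]) v = (v == b)%R%:R :> R.
Proof.
suff E : (v \in [set b]) = (v == b) by rewrite indicE E.
by apply/idP/eqP => [/set_mem//|->]; apply/mem_set.
Qed.

(** The value [delta] is inserted at the jump only when it lies between the two one-sided values 0
    and [alpha]. *)
Lemma refraction_rate_nondecreasing :
  {homo refraction_rate alpha delta b : u v / u <= v}.
Proof.
move=> u v uv; rewrite /refraction_rate !indicI !indic1.
case: ifP => [/andP[d0 da]|_];
  have [bu|ub|ub] := ltgtP b u; have [bv|vb|vb] := ltgtP b v;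
  rewrite /= ?mulr1n ?mulr0n; move: alpha_gt0; lra.
Qed.

Lemma refraction_rate_bounded v : `|refraction_rate alpha delta b v| <= alpha.
Proof.
rewrite /refraction_rate !indicI !indic1.
case: ifP => [/andP[d0 da]|_]; have [bv|vb|vb] := ltgtP b v;
  rewrite /= ?mulr1n ?mulr0n ler_norml; move: alpha_gt0; lra.
Qed.

End refraction.

(** * Adaptedness and conclusion *)

Lemma chase_seq_measurable {R : realType} d (T : measurableType d)
    (r : R) (c : nat -> T -> R) (n : nat) :
  (forall j, (j <= n)%N -> measurable_fun setT (c j)) ->
  measurable_fun setT (fun w => chase_seq r (c ^~ w) n).
Proof.
elim: n => [|n IH] mc /=; first exact: measurable_cst.
have {}IH : measurable_fun setT (fun w => chase_seq r (c ^~ w) n).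
  by apply: IH => j jn; apply: mc; exact: leqW.
apply: measurable_minr; first exact: measurable_funD.
by apply: measurable_maxr => //; exact: mc.
Qed.

Lemma chaser_measurable {R : realType} d (T : measurableType d)
    (alpha t : R) (c : R -> T -> R) : 0 <= alpha -> 0 <= t ->
  (forall s, 0 <= s <= t -> measurable_fun setT (c s)) ->
  measurable_fun setT (fun w => chaser alpha (c ^~ w) t).
Proof.
move=> a0 t0 mc.
(* Measurability of a real-valued upper limit asks for bounded sequences. *)
have bounds w n : 0 <= chaser_approx alpha (c ^~ w) n t <= alpha * t + alpha.
  have := chaser_approx_bounds (c ^~ w) n a0 (lexx 0) t0.
  rewrite chaser_approx0 subr0 add0r => /andP[-> /le_trans]; apply.
  rewrite lerD2l ler_pdivrMr ?exp2_gt0// -[leLHS]mulr1 ler_wpM2l//.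
  by rewrite exprn_ege1// ler1n.
apply: measurable_fun_limn_sup.
- by move=> w _; exists (alpha * t + alpha) => _ [n _ <-]; have /andP[] := bounds w n.
- by move=> w _; exists 0 => _ [n _ <-]; have /andP[] := bounds w n.
move=> n; apply: chase_seq_measurable => j jn; apply: mc.
(* The grid index is rounded down, so [c] is read only at times up to [t]; adaptedness rests on
   this. *)
rewrite divr_ge0 ?(ltW (exp2_gt0 n))//= ler_pdivrMr ?exp2_gt0//.
by rewrite -truncn_ge_nat// mulr_ge0// ltW// exp2_gt0.
Qed.

(** [chaser_measurable] is applied with [T] carrying the sigma-algebra generated by [X] up to time
    [t]. *)
Lemma adapted_sub_chaser {R : realType} d (T : measurableType d)
    (P : probability T R) (X : R -> {RV P >-> R}) (alpha b : R) : 0 <= alpha ->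
  adapted (natural_filtration X)
    (fun t w => X t w - chaser alpha (fun s => X s w - b) t).
Proof.
move=> a0 t t0 B mB.
pose G := \bigcup_(s in [set s : R | 0 <= s <= t])
  preimage_set_system setT (X s) measurable.
have mX s : 0 <= s <= t -> measurable_fun (setT : set (g_sigma_algebraType G)) (X s : T -> R).
  move=> st _ A mA; apply: sub_sigma_algebra; exists s => //.
  by exists A.
have mY : measurable_fun (setT : set (g_sigma_algebraType G))
    ((fun w => X t w - chaser alpha (fun s => X s w - b) t) : T -> R).
  apply: measurable_funB; first by apply: mX; rewrite t0 lexx.
  apply: (@chaser_measurable _ _ (g_sigma_algebraType G) _ _ (fun s w => X s w - b)) => //.
  by move=> s st; apply: measurable_funB => //; exact: mX.
have := mY measurableT B mB; rewrite setTI; exact.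
Qed.

Theorem theorem2p5 (R : realType) (d : measure_display) (T : measurableType d)
  (P : probability T R) (X : R -> {RV P >-> R}) (x gamma sigma : R)
  (Pi : {measure set (measurableTypeR R) -> \bar R}) (delta alpha b : R)
  (X_levy : levy_process X x)
  (X_char : levy_khintchine X gamma sigma Pi)
  (X_bv : bounded_variation_paths X)
  (X_drift : is_drift X Pi delta)
  (alpha_gt0 : 0 < alpha) :
  unique_strong_solution X (refraction_rate alpha delta b).
Proof.
have [_ _ X_stat X_cadlag] := X_levy.
have [_ Pi_levy _] := X_char.
split; last first.
  move=> Y Z [_ Ysol] [_ Zsol]; apply: filterS2 Ysol Zsol => w Yw Zw t t0.
  apply/le_anti/andP; split.
    exact: (solution_le (@refraction_rate_nondecreasing _ _ delta b alpha_gt0)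
      (refraction_rate_bounded delta b alpha_gt0) Yw Zw t0).
  exact: (solution_le (@refraction_rate_nondecreasing _ _ delta b alpha_gt0)
    (refraction_rate_bounded delta b alpha_gt0) Zw Yw t0).
exists (fun t w => X t w - chaser alpha (fun s => X s w - b) t); split.
  exact: adapted_sub_chaser (ltW alpha_gt0).
have [h [h_gt0 h_cvg0 slope]] :=
  ae_slope_cvg (alpha + `|delta|)^-1 X_stat Pi_levy X_drift X_cadlag.
apply: filterS3 X_cadlag X_bv slope => w [rc _] bv slope t t0.
have c_rc : right_cont (fun s => X s w - b).
  by apply: right_contB => // s _; exact: cvg_cst.
have subB s u : X s w - b - (X u w - b) = X s w - X u w by rewrite opprB addrA subrK.
have c_bv : bv_path (fun s => X s w - b).
  move=> v v0; have [V HV] := bounded_variation_path bv v0.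
  by exists V => u s u0 us sv; rewrite subB; exact: HV.
have c_slope N : (\int[lebesgue_measure]_(s in `[0%R, N%:R[)
    (1 - cos ((alpha + `|delta|)^-1 *
      ((X (s + h k)%R w - b - (X s w - b)) / h k - delta)))%:E)%E @[k --> \oo] --> 0%E.
  by under eq_fun do under eq_integral do rewrite subB; exact: slope.
have [] := chaser_equation alpha_gt0 c_rc c_bv h_gt0 h_cvg0 c_slope b t0.
set K := chaser alpha _.
have -> : (fun s => refraction_rate alpha delta b (X s w - b + b - K s)) =
    (fun s => refraction_rate alpha delta b (X s w - K s)).
  by apply/funext => s; rewrite subrK.
by move=> iY KE; split => //; rewrite {1}KE; congr (_ - _).
Qed.
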